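(* Let $f\colon\mathbb{R}^{m\times n}\to\mathbb{R}$ be twice continuously differentiable and $g\colon\mathcal{M}\to\mathbb{R}$, $g(X,P)=f(X)$. Let $(X,P)\in\mathcal{M}$ and $(\dot X,\dot P)\in\mathrm{T}_{(X,P)}\mathcal{M}$ have representations $(U,\Sigma,V)$ and $(K,V_p)$. Then $\nabla^2g(X,P)[\dot X,\dot P]$ (Riemannian Hessian) is a tangent vector at $(X,P)$ with representation $(\bar K,\bar V_p)$ given by $$\bar K=\nabla^2f(X)[\dot X]\,V+M\,\nabla f(X)V_p,\qquad \bar V_p=P\Big(\nabla^2f(X)[\dot X]^\top U\Sigma+\nabla f(X)^\top MK\Big)S(\alpha)^{-1},$$ where $M=I-U\Sigma^2S(\alpha)^{-1}U^\top$, $S(\alpha)=2\alpha I_r+\Sigma^2$, and $\nabla f,\nabla^2f$ are the Euclidean gradient and Hessian of $f$.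
   Context: Let $m,n,r$ be positive integers with $r<\min(m,n)$. $\mathrm{Sym}(n)$: real symmetric $n\times n$ matrices; $\mathrm{St}(n,r)=\{V\in\mathbb{R}^{n\times r}:V^\top V=I_r\}$; $\mathrm{Gr}(n,n-r)=\{P\in\mathrm{Sym}(n):P^2=P,\ \mathrm{rank}\,P=n-r\}$. The desingularization $\mathcal{M}=\{(X,P)\in\mathbb{R}^{m\times n}\times\mathrm{Gr}(n,n-r):XP=0\}$ is a smooth embedded submanifold of $\mathcal{E}=\mathbb{R}^{m\times n}\times\mathrm{Sym}(n)$ of dimension $(m+n-r)r$. A representation of $(X,P)\in\mathcal{M}$ is a triplet $(U,\Sigma,V)$ with $U\in\mathrm{St}(m,r)$, $V\in\mathrm{St}(n,r)$, $\Sigma\in\mathbb{R}^{r\times r}$ diagonal with nonnegative, non-increasing diagonal entries, such that $X=U\Sigma V^\top$ and $P=I-VV^\top$ (one always exists). Given it, a representation of $(\dot X,\dot P)\in\mathrm{T}_{(X,P)}\mathcal{M}$ is the (unique) pair $(K,V_p)\in\mathbb{R}^{m\times r}\times\mathbb{R}^{n\times r}$ with $V_p^\top V=0$, $\dot X=KV^\top+U\Sigma V_p^\top$, $\dot P=-V_pV^\top-VV_p^\top$; all tangent vectors, and only they, are of this form. $\mathcal{M}$ is a Riemannian submanifold of $\mathcal{E}$ with inner product $\langle(Y_1,Z_1),(Y_2,Z_2)\rangle=\langle Y_1,Y_2\rangle+\alpha\langle Z_1,Z_2\rangle$, $\alpha>0$ fixed (Frobenius inner products on the right). The Riemannian Hessian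 is the covariant derivative (Levi-Civita connection) of the Riemannian gradient. *)

(* Defs.v *)
From HB Require Import structures.
From mathcomp Require Import all_boot all_order all_algebra.
From mathcomp Require Import all_classical all_reals all_analysis.
Set Implicit Arguments.
Unset Strict Implicit.
Unset Printing Implicit Defensive.
Import Order.TTheory GRing.Theory Num.Theory.
Import numFieldNormedType.Exports.
Local Open Scope classical_set_scope.
Local Open Scope ring_scope.

(* [Ck_on k A f]: f is of class C^k on the open set A.  All spaces used below
   are finite-dimensional, so that continuity of the derivative amounts to
   continuity of every directional derivative ['D_v f]. *)
Fixpoint Ck_on (R : realType) (V W : normedModType R) (k : nat)
    (A : set V) (f : V -> W) : Prop :=
  match k with
  | 0%N => forall x, A x -> {for x, continuous f}
  | k'.+1 => (forall x, A x -> differentiable f x) /\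
             forall v : V, Ck_on k' A ('D_v f)
  end.

Definition smooth_on (R : realType) (V W : normedModType R)
    (A : set V) (f : V -> W) : Prop :=
  forall k, Ck_on k A f.

(* Calculus on an embedded submanifold M of a finite-dimensional normed
   space E.  Functions and fields on M are total functions on E of which only
   the values on M are used. *)

Definition C1_on_mfd (R : realType) (E W : normedModType R)
    (M : set E) (h : E -> W) : Prop :=
  forall x, M x -> exists (A : set E) (hbar : E -> W),
    [/\ open A, A x, Ck_on 1 A hbar & forall y, A y -> M y -> hbar y = h y].

Definition smooth_on_mfd (R : realType) (E W : normedModType R)
    (M : set E) (h : E -> W) : Prop :=
  forall x, M x -> exists (A : set E) (hbar : E -> W),
    [/\ open A, A x, smooth_on A hbar & forall y, A y -> M y -> hbar y = h y].

(* [c] is a smooth curve on M, defined near 0, with c(0) = x and c'(0) = u. *)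
Definition curve_at (R : realType) (E : normedModType R)
    (M : set E) (x u : E) (c : R -> E) : Prop :=
  [/\ exists A : set R, [/\ open A, A 0, smooth_on A c &
                            forall t, A t -> M (c t)],
      c 0 = x & is_derive (0 : R) (1 : R) c u].

Definition tangent (R : realType) (E : normedModType R)
    (M : set E) (x u : E) : Prop :=
  exists c : R -> E, curve_at M x u c.

(* Differential Dh(x)[u] of h : M -> W: the derivative at 0 of h along any
   curve with velocity u at x (well defined when h is C^1 and u tangent). *)
Definition mdiff (R : realType) (E W : normedModType R)
    (M : set E) (h : E -> W) (x u : E) : W :=
  xget 0 [set l | exists c : R -> E,
                    curve_at M x u c /\ is_derive (0 : R) (1 : R) (h \o c) l].

Definition tangent_field (R : realType) (E : normedModType R)
    (M : set E) (Y : E -> E) : Prop :=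
  forall x, M x -> tangent M x (Y x).

Definition C1_field (R : realType) (E : normedModType R)
    (M : set E) (Y : E -> E) : Prop :=
  tangent_field M Y /\ C1_on_mfd M Y.

Definition smooth_field (R : realType) (E : normedModType R)
    (M : set E) (Y : E -> E) : Prop :=
  tangent_field M Y /\ smooth_on_mfd M Y.

(* [nabla x u Y] stands for the covariant derivative at x of the field Y along
   the tangent vector u.  It acts on C^1 fields, not only on smooth ones: the
   gradient of a C^2 function is merely C^1. *)
Record connection (R : realType) (E : normedModType R) (M : set E)
    (nabla : E -> E -> (E -> E) -> E) : Prop := Connection {
  conn_tangent : forall x u Y, M x -> tangent M x u -> C1_field M Y ->
    tangent M x (nabla x u Y);
  conn_smooth : forall X Y, smooth_field M X -> smooth_field M Y ->
    smooth_field M (fun x => nabla x (X x) Y);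
  conn_linear_vector : forall x (a : R) u v Y, M x ->
    tangent M x u -> tangent M x v -> C1_field M Y ->
    nabla x (a *: u + v) Y = a *: nabla x u Y + nabla x v Y;
  conn_linear_field : forall x u (a : R) Y Z, M x -> tangent M x u ->
    C1_field M Y -> C1_field M Z ->
    nabla x u (fun y => a *: Y y + Z y) = a *: nabla x u Y + nabla x u Z;
  conn_leibniz : forall x u (h : E -> R) Y, M x -> tangent M x u ->
    C1_on_mfd M h -> C1_field M Y ->
    nabla x u (fun y => h y *: Y y) =
      mdiff M h x u *: Y x + h x *: nabla x u Y
}.

(* Torsion-freeness: [X, Y] h = (nabla_X Y - nabla_Y X) h for all smooth h,
   with [X, Y] h = X (Y h) - Y (X h). *)
Definition torsion_free (R : realType) (E : normedModType R) (M : set E)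
    (nabla : E -> E -> (E -> E) -> E) : Prop :=
  forall x X Y (h : E -> R), M x -> C1_field M X -> C1_field M Y ->
    smooth_on_mfd M h ->
    mdiff M (fun y => mdiff M h y (Y y)) x (X x) -
    mdiff M (fun y => mdiff M h y (X y)) x (Y x) =
    mdiff M h x (nabla x (X x) Y - nabla x (Y x) X).

Definition metric_compatible (R : realType) (E : normedModType R) (M : set E)
    (ip : E -> E -> R) (nabla : E -> E -> (E -> E) -> E) : Prop :=
  forall x u Y Z, M x -> tangent M x u -> C1_field M Y -> C1_field M Z ->
    mdiff M (fun y => ip (Y y) (Z y)) x u =
    ip (nabla x u Y) (Z x) + ip (Y x) (nabla x u Z).

Definition levi_civita (R : realType) (E : normedModType R) (M : set E)
    (ip : E -> E -> R) (nabla : E -> E -> (E -> E) -> E) : Prop :=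
  [/\ connection M nabla, torsion_free M nabla & metric_compatible M ip nabla].

Definition rgrad (R : realType) (E : normedModType R) (M : set E)
    (ip : E -> E -> R) (g : E -> R) (x : E) : E :=
  xget 0 [set w | tangent M x w /\
                  forall v, tangent M x v -> ip w v = mdiff M g x v].

Definition rhess (R : realType) (E : normedModType R) (M : set E)
    (ip : E -> E -> R) (nabla : E -> E -> (E -> E) -> E)
    (g : E -> R) (x u : E) : E :=
  nabla x u (rgrad M ip g).

Definition frob (R : realType) (p q : nat) (A B : 'M[R]_(p, q)) : R :=
  \tr (A^T *m B).

Definition egrad (R : realType) (m n : nat) (f : 'M[R]_(m, n) -> R)
    (X : 'M[R]_(m, n)) : 'M[R]_(m, n) :=
  \matrix_(i, j) 'D_(delta_mx i j) f X.

Definition ehess (R : realType) (m n : nat) (f : 'M[R]_(m, n) -> R)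
    (X H : 'M[R]_(m, n)) : 'M[R]_(m, n) :=
  'D_H (egrad f) X.

Definition grassmann (R : realType) (n k : nat) : set 'M[R]_n :=
  [set P | [/\ P^T = P, P *m P = P & \rank P = k]].

(* The second factor is the space of all n x n matrices rather than Sym(n):
   points, curves and tangent vectors of [desing] have a symmetric second
   component anyway, and a C^k map on an open subset of the space with Sym(n)
   extends by precomposition with the symmetrization. *)
Definition ambient (R : realType) (m n : nat) : normedModType R :=
  ('M[R]_(m, n) * 'M[R]_n)%type.

Definition desing (R : realType) (m n r : nat) : set (ambient R m n) :=
  [set x | grassmann (n - r) x.2 /\ x.1 *m x.2 = 0].

Definition ambient_ip (R : realType) (m n : nat) (alpha : R)
    (x y : ambient R m n) : R :=
  frob x.1 y.1 + alpha * frob x.2 y.2.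

Definition stiefel (R : realType) (n r : nat) : set 'M[R]_(n, r) :=
  [set V | V^T *m V = 1%:M].

Definition point_repr (R : realType) (m n r : nat) (x : ambient R m n)
    (U : 'M[R]_(m, r)) (Sigma : 'M[R]_r) (V : 'M[R]_(n, r)) : Prop :=
  [/\ stiefel U /\ stiefel V,
      is_diag_mx Sigma,
      forall i, 0 <= Sigma i i,
      forall i j : 'I_r, (i <= j)%N -> Sigma j j <= Sigma i i &
      x.1 = U *m Sigma *m V^T /\ x.2 = 1%:M - V *m V^T].

Definition tangent_repr (R : realType) (m n r : nat)
    (U : 'M[R]_(m, r)) (Sigma : 'M[R]_r) (V : 'M[R]_(n, r))
    (u : ambient R m n) (K : 'M[R]_(m, r)) (Vp : 'M[R]_(n, r)) : Prop :=
  [/\ Vp^T *m V = 0,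
      u.1 = K *m V^T + U *m Sigma *m Vp^T &
      u.2 = - (Vp *m V^T) - V *m Vp^T].

(* Main.v *)
Require Import Defs.
From HB Require Import structures.
From mathcomp Require Import all_boot all_order all_algebra.
From mathcomp Require Import ring lra.
From mathcomp Require Import all_classical all_reals all_analysis.
Import Order.TTheory GRing.Theory Num.Theory.
Import numFieldNormedType.Exports.
Local Open Scope classical_set_scope.
Local Open Scope ring_scope.
Set Implicit Arguments.
Unset Strict Implicit.
Unset Printing Implicit Defensive.

(** The Levi-Civita connection of a submanifold of a Euclidean space is the
    tangential part of the ambient derivative: the difference of the two
    operators is symmetric in its two fields (torsion) and skew in the last
    field and the test field (metric), hence zero.  Tested against a tangent
    field Z with Z(x) = z, the Hessian therefore satisfies
    [<H[u], z> = D(<grad g, Z>)[u] - <grad g, DZ[u]>], where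
    [<grad g, Z> = <egrad f, Z.1>] on the manifold, so that the gradient itself
    is never differentiated explicitly.  Tangent vectors (Xdot, Pdot) at (X, P)
    are the solutions of [Pdot^T = Pdot], [Pdot = Pdot P + P Pdot] and
    [Xdot P + X Pdot = 0], which gives polynomial extensions Z; in a
    representation (U, Sigma, V) the correction term
    [<(egrad f, 0) - grad g, DZ[u]>] reduces to
    [<M egrad f P, K' Vp^T + K Vp'^T>], with (K, Vp) and (K', Vp') representing
    u and z. *)

(** * Chain and product rules for directional derivatives *)

Section DirectionalDerivatives.
Context {R : realType}.
Implicit Types U V W : normedModType R.

(** Expansion in matrix units writes [h] as a finite sum of coordinate functions times fixed
    vectors. *)
Lemma linear_mx_continuous W p q (h : {linear 'M[R]_(p, q) -> W}) :
  continuous h.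
Proof.
have -> : h = (fun A => \sum_(ij : 'I_p * 'I_q)
                 A ij.1 ij.2 *: h (delta_mx ij.1 ij.2)) :> (_ -> _).
  apply/funext => A; rewrite {1}(matrix_sum_delta A) pair_big linear_sum.
  by apply: eq_bigr => -[i j] _; rewrite linearZ.
apply: continuous_big => [|ij _]; first exact: add_continuous.
move=> A.
apply: (@continuous_comp _ _ _ (fun A : 'M[R]_(p, q) => A ij.1 ij.2)
          (fun k : R => k *: h _)).
  exact: coord_continuous.
exact: scalel_continuous.
Qed.

Lemma differentiable_linear U V W (h : {linear V -> W}) (f : U -> V) x :
  continuous h -> differentiable f x -> differentiable (fun y => h (f y)) x.
Proof.
move=> hc df; apply: (@differentiable_comp _ _ _ _ f h) => //.
exact: linear_differentiable.
Qed.

Lemma derive_linear U V W (h : {linear V -> W}) (f : U -> V) x v :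
  continuous h -> differentiable f x ->
  'D_v (fun y => h (f y)) x = h ('D_v f x).
Proof.
move=> hc df; rewrite deriveE; last exact: differentiable_linear.
have dh : differentiable h (f x) by exact: linear_differentiable.
by rewrite (diff_comp df dh) /= diff_lin // deriveE.
Qed.

Lemma differentiable_bilinear U V V' W (B : {bilinear V -> V' -> W})
    (f : U -> V) (g : U -> V') x :
  continuous (fun p => B p.1 p.2) -> differentiable f x ->
  differentiable g x -> differentiable (fun y => B (f y) (g y)) x.
Proof.
move=> Bc df dg.
apply: (@differentiable_comp _ _ _ _ (fun y => (f y, g y))
          (fun p => B p.1 p.2)).
  exact: differentiable_pair.
exact: differentiable_bilin.
Qed.

Lemma derive_bilinear U V V' W (B : {bilinear V -> V' -> W})
    (f : U -> V) (g : U -> V') x v :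
  continuous (fun p => B p.1 p.2) -> differentiable f x ->
  differentiable g x ->
  'D_v (fun y => B (f y) (g y)) x = B ('D_v f x) (g x) + B (f x) ('D_v g x).
Proof.
move=> Bc df dg; rewrite deriveE; last exact: differentiable_bilinear.
have dp := differentiable_pair df dg.
have dB : differentiable (fun p => B p.1 p.2) (f x, g x).
  exact: differentiable_bilin.
rewrite (diff_comp dp dB) /= (diff_bilin _ Bc) /= (diff_pair df dg) /=.
by rewrite !deriveE // addrC.
Qed.

End DirectionalDerivatives.

(** * Closure properties of the class C^k on a whole space *)

Section ContinuouslyDifferentiable.
Context {R : realType}.
Implicit Types U V W : normedModType R.

Lemma CkS V W k (f : V -> W) : Ck_on k.+1 setT f -> Ck_on k setT f.
Proof.
elim: k f => [|k IH] f [df Df].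
  by move=> x Ax; apply: differentiable_continuous; exact: df.
by split=> // v; apply: IH; exact: Df.
Qed.

Lemma Ck_cst V W k (a : W) : Ck_on k setT (fun _ : V => a).
Proof.
elim: k a => [|k IH] a; first by move=> x _; exact: cst_continuous.
split=> [x _|v]; first exact: differentiable_cst.
have -> : 'D_v (fun _ : V => a) = fun=> 0.
  by apply/funext => x; exact: derive_cst.
exact: IH.
Qed.

Lemma Ck_id V k : Ck_on k setT (fun x : V => x).
Proof.
case: k => [|k]; first by move=> x _.
split=> [x _|v]; first exact: (ex_diff (f := id)).
have -> : 'D_v (fun x : V => x) = fun=> v.
  by apply/funext => x; exact: derive_id.
exact: Ck_cst.
Qed.

Lemma CkD V W k (f g : V -> W) : Ck_on k setT f -> Ck_on k setT g ->
  Ck_on k setT (fun x => f x + g x).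
Proof.
elim: k f g => [|k IH] f g.
  by move=> cf cg x _; apply: (@continuousD _ _ _ f g); [exact: cf|exact: cg].
move=> [df Df] [dg Dg]; split=> [x Ax|v].
  by apply: (@differentiableD _ _ _ f g); [exact: df|exact: dg].
have -> : 'D_v (fun x => f x + g x) = (fun x => 'D_v f x + 'D_v g x).
  apply/funext => x.
  rewrite -[LHS]/('D_v (f + g) x) deriveD //; apply: diff_derivable.
    exact: df.
  exact: dg.
by apply: (IH ('D_v f) ('D_v g)); [exact: Df|exact: Dg].
Qed.

Lemma Ck_linear U V W k (h : {linear V -> W}) (f : U -> V) :
  continuous h -> Ck_on k setT f -> Ck_on k setT (fun x => h (f x)).
Proof.
move=> hc; elim: k f => [|k IH] f.
  by move=> cf x Ax; apply: (@continuous_comp _ _ _ f h); [exact: cf|exact: hc].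
move=> [df Df]; split=> [x Ax|v].
  by apply: differentiable_linear => //; exact: df.
have -> : 'D_v (fun x => h (f x)) = (fun x => h ('D_v f x)).
  by apply/funext => x; apply: derive_linear => //; exact: df.
by apply: (IH ('D_v f)); exact: Df.
Qed.

(** The derivative of the composite along [v] is the derivative of [f] along the fixed direction
    [h v], composed with [h]: a map of the same form, so the induction closes. *)
Lemma Ck_precomp_linear U V W k (h : {linear U -> V}) (f : V -> W) :
  continuous h -> Ck_on k setT f -> Ck_on k setT (fun x => f (h x)).
Proof.
move=> hc; elim: k f => [|k IH] f.
  by move=> cf x Ax; apply: (@continuous_comp _ _ _ h f); [exact: hc|exact: cf].
move=> [df Df]; have dh x : differentiable h x by exact: linear_differentiable.
split=> [x Ax|v].
  by apply: (@differentiable_comp _ _ _ _ h f) => //; exact: df.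
have -> : 'D_v (fun x => f (h x)) = (fun x => 'D_(h v) f (h x)).
  apply/funext => x; have dfx := df (h x) I.
  rewrite deriveE; last exact: (@differentiable_comp _ _ _ _ h f).
  by rewrite (diff_comp (dh x) dfx) /= diff_lin // deriveE.
by apply: (IH ('D_(h v) f)); exact: Df.
Qed.

(** The product rule gives two terms of the same shape, each with one factor differentiated; the
    other factor is brought down to order k by [CkS]. *)
Lemma Ck_bilinear U V V' W k (B : {bilinear V -> V' -> W})
    (f : U -> V) (g : U -> V') :
  continuous (fun p => B p.1 p.2) ->
  Ck_on k setT f -> Ck_on k setT g -> Ck_on k setT (fun x => B (f x) (g x)).
Proof.
move=> Bc; elim: k f g => [|k IH] f g.
  move=> cf cg x Ax.
  apply: (@continuous_comp _ _ _ (fun y => (f y, g y)) (fun p => B p.1 p.2)).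
    by apply: cvg_pair; [exact: cf|exact: cg].
  exact: Bc.
move=> Cf Cg; have [df Df] := Cf; have [dg Dg] := Cg.
split=> [x Ax|v].
  by apply: differentiable_bilinear => //; [exact: df|exact: dg].
have -> : 'D_v (fun x => B (f x) (g x)) =
    (fun x => B ('D_v f x) (g x) + B (f x) ('D_v g x)).
  by apply/funext => x; apply: derive_bilinear => //; [exact: df|exact: dg].
apply: CkD.
  by apply: (IH ('D_v f) g); [exact: Df|exact: CkS].
by apply: (IH f ('D_v g)); [exact: CkS|exact: Dg].
Qed.

Lemma Ck_sum V W k (I : Type) (s : seq I) (f : I -> V -> W) :
  (forall i, Ck_on k setT (f i)) -> Ck_on k setT (fun x => \sum_(i <- s) f i x).
Proof.
move=> Cf; elim: s => [|i s IH].
  under eq_fun do rewrite big_nil; exact: Ck_cst.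
under eq_fun do rewrite big_cons.
by apply: CkD.
Qed.

Lemma CkM V k (f g : V -> R) : Ck_on k setT f -> Ck_on k setT g ->
  Ck_on k setT (fun x => f x * g x).
Proof.
by apply: (@Ck_bilinear _ _ _ _ _ *%R) => -[a b]; exact: mul_continuous.
Qed.

Lemma Ck_prod V k (I : Type) (s : seq I) (f : I -> V -> R) :
  (forall i, Ck_on k setT (f i)) ->
  Ck_on k setT (fun x => \prod_(i <- s) f i x).
Proof.
move=> Cf; elim: s => [|i s IH].
  under eq_fun do rewrite big_nil; exact: Ck_cst.
under eq_fun do rewrite big_cons.
by apply: CkM.
Qed.

(** The derivative of 1/f is -(1/f)^2 times that of f, so regularity of 1/f at order k yields
    regularity at order k + 1. *)
Lemma CkV V k (f : V -> R) : (forall x, f x != 0) -> Ck_on k setT f ->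
  Ck_on k setT (fun x => (f x)^-1).
Proof.
move=> f0; elim: k => [|k IH] Cf.
  by move=> x Ax; apply: continuousV => //; exact: Cf.
have [df Df] := Cf; split=> [x Ax|v].
  by apply: differentiableV; [exact: df|].
have -> : 'D_v (fun x => (f x)^-1) =
    (fun x => (-1) * ((f x)^-1 * (f x)^-1) * 'D_v f x).
  apply/funext => x; rewrite deriveV //; last by apply: diff_derivable; exact: df.
  by rewrite /GRing.scale /= expr2 invfM mulN1r.
have CVf := IH (CkS Cf).
by apply: CkM (Df v); apply: CkM; [exact: Ck_cst|exact: CkM].
Qed.

Lemma Ck_coord V k p q (N : V -> 'M[R]_(p, q)) i j :
  Ck_on k setT N -> Ck_on k setT (fun x => N x i j).
Proof.
have lin : linear (fun A : 'M[R]_(p, q) => A i j).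
  by move=> a A B; rewrite !mxE.
pose hM := GRing.isLinear.Build _ _ _ _ _ lin.
pose h : {linear _ -> _} := HB.pack (fun A : 'M[R]_(p, q) => A i j) hM.
by apply: (@Ck_linear _ _ _ _ h); exact: coord_continuous.
Qed.

Lemma Ck_scalel V W k (f : V -> R) (w : W) :
  Ck_on k setT f -> Ck_on k setT (fun x => f x *: w).
Proof.
have lin : linear (fun a : R => a *: w).
  by move=> a b c; rewrite scalerDl scalerA.
pose hM := GRing.isLinear.Build _ _ _ _ _ lin.
pose h : {linear R -> W} := HB.pack (fun a : R => a *: w) hM.
by apply: (@Ck_linear _ _ _ _ h) => a; exact: scalel_continuous.
Qed.

Lemma Ck_mx V k p q (N : V -> 'M[R]_(p, q)) :
  (forall i j, Ck_on k setT (fun x => N x i j)) -> Ck_on k setT N.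
Proof.
move=> CN; have -> : N = (fun x => \sum_i \sum_j N x i j *: delta_mx i j).
  by apply/funext => x; exact: matrix_sum_delta.
by apply: Ck_sum => i; apply: Ck_sum => j; exact: Ck_scalel.
Qed.

Lemma Ck_det V k p (N : V -> 'M[R]_p) :
  Ck_on k setT N -> Ck_on k setT (fun x => \det (N x)).
Proof.
move=> CN; rewrite /determinant; apply: Ck_sum => s.
apply: CkM; first exact: Ck_cst.
by apply: Ck_prod => i; exact: Ck_coord.
Qed.

(** By the cofactor formula each entry of the inverse is a polynomial in the entries of [N x]
    divided by a determinant that never vanishes. *)
Lemma Ck_invmx V k p (N : V -> 'M[R]_p) :
  (forall x, N x \in unitmx) -> Ck_on k setT N ->
  Ck_on k setT (fun x => invmx (N x)).
Proof.
move=> uN CN; apply: Ck_mx => i j.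
have -> : (fun x => invmx (N x) i j) =
    (fun x => (\det (N x))^-1 * ((-1) ^+ (j + i) * \det (row' j (col' i (N x))))).
  by apply/funext => x; rewrite /invmx uN !mxE.
apply: CkM; first by apply: CkV (Ck_det CN) => x; rewrite -unitfE -unitmxE.
apply: CkM; first exact: Ck_cst.
apply: Ck_det; apply: Ck_mx => a b.
by under eq_fun do rewrite !mxE; exact: Ck_coord.
Qed.

End ContinuouslyDifferentiable.

(** * Differentials of maps along a submanifold *)

Section EmbeddedManifolds.
Context {R : realType}.
Implicit Types E W : normedModType R.

Lemma is_derive_comp_curve E W (F : E -> W) (c : R -> E) u :
  differentiable F (c 0) -> is_derive (0 : R) (1 : R) c u ->
  is_derive (0 : R) (1 : R) (F \o c) ('D_u F (c 0)).
Proof.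
move=> dF [dc <-].
have {}dc : differentiable c 0 by apply/derivable1_diffP.
apply: DeriveDef; first by apply/derivable1_diffP; exact: differentiable_comp.
rewrite deriveE; last exact: differentiable_comp.
by rewrite (diff_comp dc dF) /= !deriveE.
Qed.

(** The value that [xget] picks in [mdiff] is forced: near 0 a curve stays in both [A] and [M], so
    [h] has along it the derivative of the local extension [hbar]. The curve [c0] shows that there
    is a value to pick. *)
Lemma mdiff_derive E W (M : set E) (h hbar : E -> W) (A : set E) x u :
  tangent M x u -> open A -> A x -> differentiable hbar x ->
  (forall y, A y -> M y -> hbar y = h y) -> mdiff M h x u = 'D_u hbar x.
Proof.
move=> [c0 c0xu] oA Ax dh hE.
have dcurve c : curve_at M x u c ->
    is_derive (0 : R) (1 : R) (h \o c) ('D_u hbar x).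
  move=> [[B [oB B0 _ MB]] c0x dc].
  apply: (@near_eq_is_derive _ _ _ (hbar \o c)); last first.
    by rewrite -c0x; apply: is_derive_comp_curve => //; rewrite c0x.
  have cc : {for 0, continuous c}.
    by apply: differentiable_continuous; apply/derivable1_diffP; case: dc.
  have nA : \forall t \near 0, A (c t).
    by apply: cc; rewrite c0x; exact: open_nbhs_nbhs.
  have nB : \forall t \near 0, B t by exact: open_nbhs_nbhs.
  by near=> t; apply: hE; [near: t|apply: MB; near: t].
have [c [/dcurve [_ <-] [_ <-]]] // : [set l | exists c, curve_at M x u c /\
    is_derive (0 : R) (1 : R) (h \o c) l] (mdiff M h x u).
by apply: (@xgetPex _ 0); exists ('D_u hbar x), c0; split=> //; exact: dcurve.
Unshelve. all: by end_near. Qed.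

Lemma eq_mdiff E W (M : set E) (h k : E -> W) x u :
  (forall y, M y -> h y = k y) -> mdiff M h x u = mdiff M k x u.
Proof.
move=> hk; congr (xget 0 _); apply/seteqP.
have aux (h1 h2 : E -> W) l : (forall y, M y -> h1 y = h2 y) ->
    (exists c, curve_at M x u c /\ is_derive (0 : R) (1 : R) (h1 \o c) l) ->
    exists c, curve_at M x u c /\ is_derive (0 : R) (1 : R) (h2 \o c) l.
  move=> h12 [c [cu dc]]; exists c; split=> //.
  apply: near_eq_is_derive dc; have [[B [oB B0 _ MB]] _ _] := cu.
  have nB : \forall t \near 0, B t by exact: open_nbhs_nbhs.
  by near=> t; apply: h12; apply: MB; near: t.
by split=> l; apply: aux => // y /hk.
Unshelve. all: by end_near. Qed.

Lemma mdiff_setT E W (M : set E) (h : E -> W) x u :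
  tangent M x u -> differentiable h x -> mdiff M h x u = 'D_u h x.
Proof. by move=> Tu dh; apply: (mdiff_derive Tu openT). Qed.

(** This turns each equation that holds on [M] into a linear equation for tangent vectors. *)
Lemma derive_tangent_eq0 E W (M : set E) (F : E -> W) x u :
  tangent M x u -> differentiable F x -> (forall y, M y -> F y = 0) ->
  'D_u F x = 0.
Proof.
move=> Tu dF F0; rewrite -(mdiff_setT Tu dF) (eq_mdiff _ _ F0).
by rewrite (mdiff_setT Tu) ?derive_cst //; exact: differentiable_cst.
Qed.

Lemma C1_on_mfdT E W (M : set E) (h hbar : E -> W) :
  Ck_on 1 setT hbar -> (forall y, M y -> hbar y = h y) -> C1_on_mfd M h.
Proof.
move=> Ch hE x Mx; exists setT, hbar.
by split=> // [|y _ /hE //]; exact: openT.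
Qed.

(** * The Levi-Civita connection compared with the ambient derivative *)

Section LeviCivitaInAmbientSpace.
Context {E : normedModType R} (ip : {bilinear E -> E -> R}) (M : set E)
  (nabla : E -> E -> (E -> E) -> E).
Hypothesis ip_cont : continuous (fun p : E * E => ip p.1 p.2).
Hypothesis ipC : forall v w, ip v w = ip w v.

Hypothesis tangentB : forall x u v, M x -> tangent M x u -> tangent M x v ->
  tangent M x (u - v).

Lemma mdiff_ip (Y Z : E -> E) x u : M x -> tangent M x u ->
  C1_on_mfd M Y -> C1_on_mfd M Z ->
  mdiff M (fun y => ip (Y y) (Z y)) x u =
    ip (mdiff M Y x u) (Z x) + ip (Y x) (mdiff M Z x u).
Proof.
move=> Mx Tu /(_ x Mx) [A [Yb [oA Ax [dY _] YE]]].
move=> /(_ x Mx) [B [Zb [oB Bx [dZ _] ZE]]].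
rewrite (mdiff_derive Tu oA Ax (dY _ Ax) YE) (mdiff_derive Tu oB Bx (dZ _ Bx) ZE).
rewrite -YE // -ZE // -derive_bilinear //; last 2 first.
- exact: dY.
- exact: dZ.
apply: (mdiff_derive Tu (openI oA oB)) => //.
  by apply: differentiable_bilinear => //; [exact: dY|exact: dZ].
by move=> y [Ay By] My; rewrite YE // ZE.
Qed.

Lemma ipr_continuous w : continuous (ip w).
Proof.
move=> v; apply: (@continuous_comp _ _ _ (fun v => (w, v)) (fun p => ip p.1 p.2)).
  by apply: cvg_pair => //; exact: cvg_cst.
exact: ip_cont.
Qed.

(** Torsion-freeness is tested on the linear function [ip w]. It is its own differential at every
    point, so its iterated derivatives along the two fields involve only first derivatives of the
    fields. *)
Lemma torsion_free_ambient X Y x w : M x -> torsion_free M nabla ->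
  connection M nabla ->
  C1_field M X -> C1_field M Y ->
  ip w (nabla x (X x) Y - nabla x (Y x) X) =
    ip w (mdiff M Y x (X x)) - ip w (mdiff M X x (Y x)).
Proof.
move=> Mx tf cn CX CY; have [TX C1X] := CX; have [TY C1Y] := CY.
have Ck_ip k : Ck_on k setT (ip w).
  exact: (Ck_linear (h := ip w) (@ipr_continuous w) (Ck_id _ k)).
have d_ip y : differentiable (ip w) y by have [+ _] := Ck_ip 1%N; exact.
have mdiff_ipr y u : tangent M y u -> mdiff M (ip w) y u = ip w u.
  move=> Tu; rewrite (mdiff_setT Tu (d_ip y)) deriveE // diff_lin //.
  exact: ipr_continuous.
have sm : smooth_on_mfd M (ip w).
  by move=> y My; exists setT, (ip w); split=> //; exact: openT.
have mdiff_field (Z : E -> E) u : tangent_field M Z -> tangent M x u ->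
    C1_on_mfd M Z ->
    mdiff M (fun y => mdiff M (ip w) y (Z y)) x u = ip w (mdiff M Z x u).
  move=> TZ Tu CZ; rewrite (@eq_mdiff _ _ _ _ (fun y => ip w (Z y))); last first.
    by move=> y My; rewrite mdiff_ipr //; exact: TZ.
  rewrite (@mdiff_ip (fun=> w)) //; last first.
    by apply: (@C1_on_mfdT _ _ _ _ (fun=> w)) => //; exact: Ck_cst.
  have -> : mdiff M (fun=> w) x u = 0.
    by rewrite (mdiff_setT Tu) ?derive_cst //; exact: differentiable_cst.
  by rewrite linear0l add0r.
have := tf x X Y _ Mx CX CY sm.
have [TXx TYx] := (TX x Mx, TY x Mx).
rewrite !mdiff_field // => ->; rewrite mdiff_ipr //.
by apply: tangentB => //; exact: (conn_tangent cn).
Qed.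

Lemma levi_civita_ambient X Y Z x : M x -> levi_civita M ip nabla ->
  C1_field M X -> C1_field M Y -> C1_field M Z ->
  ip (nabla x (X x) Y) (Z x) = ip (mdiff M Y x (X x)) (Z x).
Proof.
move=> Mx [cn tf mc] CX CY CZ.
pose a X Y Z := ip (nabla x (X x) Y) (Z x) - ip (mdiff M Y x (X x)) (Z x).
have aC P Q S : C1_field M P -> C1_field M Q -> a P Q S = a Q P S.
  move=> CP CQ; apply/eqP; rewrite -subr_eq0 /a !(ipC _ (S x)); apply/eqP.
  have := torsion_free_ambient (S x) Mx tf cn CP CQ.
  by rewrite linearB /= => /eqP; rewrite subr_eq => /eqP ->; ring.
have aN P Q S : C1_field M P -> C1_field M Q -> C1_field M S ->
    a P Q S = - a P S Q.
  move=> [TP _] CQ CS; apply/eqP; rewrite -subr_eq0 opprK /a; apply/eqP.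
  have := mc x (P x) Q S Mx (TP x Mx) CQ CS.
  rewrite mdiff_ip //; [|exact: TP|by case: CQ|by case: CS].
  rewrite (ipC (nabla x (P x) S)) (ipC (mdiff M S x (P x))) => eqD.
  by rewrite addrACA -eqD -opprD subrr.
(* Alternating the symmetry [aC] and the skewness [aN], three times each, restores the order of the
   arguments with sign -1. *)
have : a X Y Z = - a X Y Z.
  by rewrite {1}aC // aN // aC // aN // opprK aC // aN.
move=> /eqP; rewrite -addr_eq0 -mulr2n mulrn_eq0 /= => /eqP.
by rewrite /a => /eqP; rewrite subr_eq0 => /eqP.
Qed.

End LeviCivitaInAmbientSpace.
End EmbeddedManifolds.

(** * The Frobenius product and invertibility criteria drawn from its positivity *)

Section FrobeniusProduct.
Context {R : realType}.

Lemma frobE p q (A B : 'M[R]_(p, q)) :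
  frob A B = \sum_i \sum_j A i j * B i j.
Proof.
rewrite /frob /mxtrace exchange_big; apply: eq_bigr => j _.
by rewrite mxE; apply: eq_bigr => i _; rewrite mxE.
Qed.

Lemma frobC p q (A B : 'M[R]_(p, q)) : frob A B = frob B A.
Proof. by rewrite /frob -mxtrace_tr trmx_mul trmxK. Qed.

Lemma frob_tr p q (A B : 'M[R]_(p, q)) : frob A^T B^T = frob A B.
Proof. by rewrite frobC /frob trmxK mxtrace_mulC. Qed.

Lemma frob_mulmxr p q s (A : 'M[R]_(p, s)) (B : 'M[R]_(p, q)) (C : 'M[R]_(q, s)) :
  frob A (B *m C) = frob (A *m C^T) B.
Proof.
by rewrite /frob trmx_mul trmxK -[in RHS]mulmxA [RHS]mxtrace_mulC mulmxA.
Qed.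

Lemma frob_mulmxl p q s (A : 'M[R]_(p, s)) (B : 'M[R]_(p, q)) (C : 'M[R]_(q, s)) :
  frob A (B *m C) = frob (B^T *m A) C.
Proof. by rewrite /frob trmx_mul trmxK mulmxA. Qed.

Lemma frob_linear p q (A : 'M[R]_(p, q)) : linear (frob A).
Proof. by move=> a B C; rewrite /frob mulmxDr -scalemxAr linearD linearZ. Qed.

HB.instance Definition _ p q (A : 'M[R]_(p, q)) :=
  GRing.isLinear.Build R _ R _ (frob A) (frob_linear A).

Lemma frobDl p q (A B C : 'M[R]_(p, q)) : frob (A + B) C = frob A C + frob B C.
Proof. by rewrite frobC linearD /= (frobC C A) (frobC C B). Qed.

Lemma frobNl p q (A C : 'M[R]_(p, q)) : frob (- A) C = - frob A C.
Proof. by rewrite frobC linearN /= (frobC C A). Qed.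

Lemma frobDr p q (A B C : 'M[R]_(p, q)) : frob A (B + C) = frob A B + frob A C.
Proof. exact: linearD. Qed.

Lemma frobNr p q (A C : 'M[R]_(p, q)) : frob A (- C) = - frob A C.
Proof. exact: linearN. Qed.

Lemma frob0l p q (A : 'M[R]_(p, q)) : frob 0 A = 0.
Proof. by rewrite frobC linear0. Qed.

Lemma frob_ge0 p q (A : 'M[R]_(p, q)) : 0 <= frob A A.
Proof.
by rewrite frobE; do 2 (apply: sumr_ge0 => ? _); rewrite -expr2 sqr_ge0.
Qed.

Lemma frob_eq0 p q (A : 'M[R]_(p, q)) : frob A A = 0 -> A = 0.
Proof.
rewrite frobE => /eqP A0; apply/matrixP => i j; rewrite mxE; apply/eqP.
move: A0; rewrite psumr_eq0 => [/allP/(_ i (mem_index_enum _))|]; last first.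
  by move=> *; apply: sumr_ge0 => ? _; rewrite -expr2 sqr_ge0.
rewrite psumr_eq0 => [/allP/(_ j (mem_index_enum _))|]; last first.
  by move=> *; rewrite -expr2 sqr_ge0.
by rewrite mulf_eq0 orbb.
Qed.

Lemma unitmx_ker0 p (A : 'M[R]_p) :
  (forall v : 'rV_p, v *m A = 0 -> v = 0) -> A \in unitmx.
Proof. by rewrite -row_free_unit; exact: inj_row_free. Qed.

(** A left kernel vector v, paired with 0 = v (a + A^T A), gives a |v|^2 + |v A^T|^2 = 0. *)
Lemma unitmx_scalarD_gram p q (a : R) (A : 'M[R]_(p, q)) : 0 < a ->
  a%:M + A^T *m A \in unitmx.
Proof.
move=> a0; apply: unitmx_ker0 => v vA0; apply: frob_eq0.
have : frob v (v *m (a%:M + A^T *m A)) = 0 by rewrite vA0 linear0.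
rewrite mulmxDr mul_mx_scalar frobDr linearZ /= mulmxA [X in _ + X]frob_mulmxr.
have := frob_ge0 v; have := frob_ge0 (v *m A^T); rewrite /GRing.scale /= => *.
by nra.
Qed.

(** Skewness makes <v, v A> vanish, so a left kernel vector of 1 - A satisfies |v|^2 = 0. *)
Lemma unitmx_1B_skew p (A : 'M[R]_p) : A^T = - A -> 1%:M - A \in unitmx.
Proof.
move=> AT; apply: unitmx_ker0 => v vA0; apply: frob_eq0.
have : frob v (v *m (1%:M - A)) = 0 by rewrite vA0 linear0.
have : frob v (v *m A) = - frob v (v *m A).
  by rewrite {1}frob_mulmxr AT mulmxN frobNl frobC.
rewrite mulmxBr mulmx1 frobDr frobNr; lra.
Qed.

End FrobeniusProduct.

(** * Regularity and derivatives of matrix expressions *)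

Section MatrixCalculus.
Context {R : realType}.
Implicit Types U V W : normedModType R.

Lemma mulmx_is_bilinear p q s :
  bilinear_for (GRing.Scale.Law.clone _ _ *:%R _)
    (GRing.Scale.Law.clone _ _ *:%R _) (@mulmx R p q s).
Proof.
split=> [B|A] a C D /=; first by rewrite mulmxDl scalemxAl.
by rewrite mulmxDr scalemxAr.
Qed.

HB.instance Definition _ p q s :=
  bilinear_isBilinear.Build R _ _ _ _ _ (@mulmx R p q s)
    (@mulmx_is_bilinear p q s).

Lemma fst_continuous V W : continuous (fst : V * W -> V).
Proof. by move=> x; exact: cvg_fst. Qed.

Lemma snd_continuous V W : continuous (snd : V * W -> W).
Proof. by move=> x; exact: cvg_snd. Qed.

Lemma Ck_fst V W k : Ck_on k setT (fun x : V * W => x.1).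
Proof.
exact: (Ck_linear (h := fst) (@fst_continuous V W) (@Ck_id _ _ k)).
Qed.

Lemma Ck_snd V W k : Ck_on k setT (fun x : V * W => x.2).
Proof.
exact: (Ck_linear (h := snd) (@snd_continuous V W) (@Ck_id _ _ k)).
Qed.

Lemma mulmx_continuous p q s :
  continuous (fun AB : 'M[R]_(p, q) * 'M[R]_(q, s) => AB.1 *m AB.2).
Proof.
suff C0 k : Ck_on k setT
    (fun AB : 'M[R]_(p, q) * 'M[R]_(q, s) => AB.1 *m AB.2).
  by move=> AB; exact: (C0 0%N).
apply: Ck_mx => i j; under eq_fun do rewrite mxE.
apply: Ck_sum => l; apply: CkM; apply: Ck_coord; first exact: Ck_fst.
exact: Ck_snd.
Qed.

Lemma trmx_continuous p q : continuous (@trmx R p q).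
Proof. exact: linear_mx_continuous. Qed.

Lemma Ck_mulmx V k p q s (f : V -> 'M[R]_(p, q)) (g : V -> 'M[R]_(q, s)) :
  Ck_on k setT f -> Ck_on k setT g -> Ck_on k setT (fun x => f x *m g x).
Proof. exact: (Ck_bilinear (@mulmx_continuous p q s)). Qed.

Lemma Ck_trmx V k p q (f : V -> 'M[R]_(p, q)) :
  Ck_on k setT f -> Ck_on k setT (fun x => (f x)^T).
Proof. exact: (Ck_linear (@trmx_continuous p q)). Qed.

Lemma Ck_frob V k p q (f g : V -> 'M[R]_(p, q)) :
  Ck_on k setT f -> Ck_on k setT g -> Ck_on k setT (fun x => frob (f x) (g x)).
Proof.
move=> Cf Cg; apply: (Ck_linear (h := mxtrace)); first exact: linear_mx_continuous.
by apply: Ck_mulmx => //; exact: Ck_trmx.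
Qed.

Lemma CkN V W k (f : V -> W) : Ck_on k setT f -> Ck_on k setT (fun x => - f x).
Proof. by apply: (Ck_linear (h := -%R)) => x; exact: opp_continuous. Qed.

Lemma CkB V W k (f g : V -> W) : Ck_on k setT f -> Ck_on k setT g ->
  Ck_on k setT (fun x => f x - g x).
Proof. by move=> Cf Cg; apply: CkD => //; exact: CkN. Qed.

Lemma Ck_pair U V W k (f : U -> V) (g : U -> W) :
  Ck_on k setT f -> Ck_on k setT g -> Ck_on k setT (fun x => (f x, g x)).
Proof.
elim: k f g => [|k IH] f g.
  by move=> cf cg x Ax; apply: cvg_pair; [exact: cf|exact: cg].
move=> [df Df] [dg Dg]; split=> [x Ax|v].
  by apply: differentiable_pair; [exact: df|exact: dg].
have -> : 'D_v (fun x => (f x, g x)) = (fun x => ('D_v f x, 'D_v g x)).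
  apply/funext => x; have dfx := df x I; have dgx := dg x I.
  rewrite deriveE; last exact: differentiable_pair.
  by rewrite (diff_pair dfx dgx) /= !deriveE.
by apply: IH; [exact: Df|exact: Dg].
Qed.

(* Differentiability is recorded together with the value of the directional
   derivative so that derivatives of matrix polynomials can be computed
   by composing proof terms. *)
Definition diff_along V W (f : V -> W) (x v : V) (df : W) :=
  differentiable f x /\ 'D_v f x = df.

Section DiffAlong.
Context {V : normedModType R} (x v : V).

Lemma diff_along_cst W (a : W) : diff_along (fun=> a) x v 0.
Proof. by split; [exact: differentiable_cst|exact: derive_cst]. Qed.

Lemma diff_along_linear U W (h : {linear U -> W}) (f : V -> U) df :
  continuous h -> diff_along f x v df ->
  diff_along (fun y => h (f y)) x v (h df).
Proof.
move=> hc [dfx <-]; split; first exact: differentiable_linear.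
exact: derive_linear.
Qed.

Lemma diff_alongD W (f g : V -> W) df dg :
  diff_along f x v df -> diff_along g x v dg ->
  diff_along (fun y => f y + g y) x v (df + dg).
Proof.
move=> [dfx <-] [dgx <-]; split; first exact: (differentiableD dfx dgx).
rewrite -[LHS]/('D_v (f + g) x) deriveD //; exact: diff_derivable.
Qed.

Lemma diff_alongN W (f : V -> W) df :
  diff_along f x v df -> diff_along (fun y => - f y) x v (- df).
Proof. by apply: (diff_along_linear (h := -%R)) => y; exact: opp_continuous. Qed.

Lemma diff_alongB W (f g : V -> W) df dg :
  diff_along f x v df -> diff_along g x v dg ->
  diff_along (fun y => f y - g y) x v (df - dg).
Proof. by move=> dfx dgx; apply: diff_alongD => //; exact: diff_alongN. Qed.

Lemma diff_along_mulmx p q s (f : V -> 'M[R]_(p, q)) (g : V -> 'M[R]_(q, s))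
    df dg :
  diff_along f x v df -> diff_along g x v dg ->
  diff_along (fun y => f y *m g y) x v (df *m g x + f x *m dg).
Proof.
move=> [dfx <-] [dgx <-]; split.
  exact: (differentiable_bilinear (@mulmx_continuous p q s)).
exact: (derive_bilinear _ (@mulmx_continuous p q s)).
Qed.

Lemma diff_along_trmx p q (f : V -> 'M[R]_(p, q)) df :
  diff_along f x v df -> diff_along (fun y => (f y)^T) x v df^T.
Proof. exact: (diff_along_linear (@trmx_continuous p q)). Qed.

Lemma diff_along_id : diff_along (fun y => y) x v v.
Proof. by split; [exact: (ex_diff (f := id))|exact: derive_id]. Qed.

Lemma diff_along_scalel W (f : V -> R) (w : W) (df : R) :
  diff_along f x v df -> diff_along (fun y => f y *: w) x v (df *: w).
Proof.
move=> [dfx <-]; have dfw := @differentiableZl _ _ _ _ w _ dfx; split=> //.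
by rewrite deriveE // (diffZl w dfx) deriveE.
Qed.

End DiffAlong.

Lemma diff_along_frob V p q (f g : V -> 'M[R]_(p, q)) x v df dg :
  diff_along f x v df -> diff_along g x v dg ->
  diff_along (fun y => frob (f y) (g y)) x v (frob df (g x) + frob (f x) dg).
Proof.
move=> dfx dgx; rewrite /frob -linearD /=.
apply: (diff_along_linear (h := mxtrace)); first exact: linear_mx_continuous.
by apply: diff_along_mulmx => //; exact: diff_along_trmx.
Qed.

Lemma diff_along_precomp_linear U V W (h : {linear U -> V}) (f : V -> W) x v df :
  continuous h -> diff_along f (h x) (h v) df ->
  diff_along (fun y => f (h y)) x v df.
Proof.
move=> hc [dfx <-]; have dh : differentiable h x by exact: linear_differentiable.
split; first exact: (differentiable_comp dh dfx).
rewrite deriveE; last exact: (differentiable_comp dh dfx).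
by rewrite (diff_comp dh dfx) /= diff_lin // deriveE.
Qed.

Lemma diff_along_fst V W (x v : V * W) : diff_along (fun y => y.1) x v v.1.
Proof.
exact: (diff_along_linear (h := fst) (@fst_continuous V W) (diff_along_id x v)).
Qed.

Lemma diff_along_snd V W (x v : V * W) : diff_along (fun y => y.2) x v v.2.
Proof.
exact: (diff_along_linear (h := snd) (@snd_continuous V W) (diff_along_id x v)).
Qed.

Lemma diff_along_pair U V W (f : U -> V) (g : U -> W) x v df dg :
  diff_along f x v df -> diff_along g x v dg ->
  diff_along (fun y => (f y, g y)) x v (df, dg).
Proof.
move=> [dfx <-] [dgx <-]; split; first exact: differentiable_pair.
rewrite deriveE; last exact: differentiable_pair.
by rewrite (diff_pair dfx dgx) /= !deriveE.
Qed.

End MatrixCalculus.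

(** * Tangent spaces of the desingularization *)

Section Desingularization.
Context {R : realType} {m n r : nat}.
Implicit Types x u v : ambient R m n.
Local Notation M := (@desing R m n r).

(** The linearization of P^T = P, P^2 = P and X P = 0; at points of [desing] it is equivalent to
    [tangent], by the lemmas below. *)
Definition tangent_eqs x u : Prop :=
  [/\ u.2^T = u.2, u.2 = u.2 *m x.2 + x.2 *m u.2 &
      u.1 *m x.2 + x.1 *m u.2 = 0].

Lemma tangent_tangent_eqs x u : tangent M x u -> tangent_eqs x u.
Proof.
move=> Tu; have d1 := diff_along_fst x u; have d2 := diff_along_snd x u.
split.
- have [dF DF] := diff_alongB (diff_along_trmx d2) d2.
  apply/eqP; rewrite -subr_eq0 -DF; apply/eqP.
  by apply: derive_tangent_eq0 Tu dF _ => y [[-> _ _] _]; rewrite subrr.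
- have [dF DF] := diff_alongB d2 (diff_along_mulmx d2 d2).
  apply/eqP; rewrite -subr_eq0 -DF; apply/eqP.
  by apply: derive_tangent_eq0 Tu dF _ => y [[_ -> _] _]; rewrite subrr.
- have [dF DF] := diff_along_mulmx d1 d2.
  by rewrite -DF; apply: derive_tangent_eq0 Tu dF _ => y [].
Qed.

(** Multiplying Pdot = Pdot P + P Pdot by P on both sides gives P Pdot P = 2 P Pdot P. *)
Lemma tangent_eqs_PDP x u : M x -> tangent_eqs x u -> x.2 *m u.2 *m x.2 = 0.
Proof.
move=> [[_ PP _] _] [_ /(congr1 (fun B => x.2 *m B *m x.2)) + _].
rewrite mulmxDr mulmxDl !mulmxA PP -(mulmxA _ x.2 x.2) PP => /eqP.
by rewrite -subr_eq0 opprD addrA subrr sub0r oppr_eq0 => /eqP.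
Qed.

(* The Cayley transform of the skew matrix [t Om], with
   [2 Om = Pdot P - P Pdot], is orthogonal; conjugating P by it gives a curve of
   projections of constant rank with velocity Pdot. *)
Lemma tangent_eqs_tangent x u : M x -> tangent_eqs x u -> tangent M x u.
Proof.
move=> Mx Tu; have PDP := tangent_eqs_PDP Mx Tu.
have [[PT PP rP] XP] := Mx; have [DT DE DX] := Tu.
pose Om := (2^-1 : R) *: (u.2 *m x.2 - x.2 *m u.2).
have OmT : Om^T = - Om.
  by rewrite linearZ /= linearB /= !trmx_mul PT DT -scalerN opprB.
pose N (t : R) := 1%:M - t *: Om.
have NT t : (N t)^T = 1%:M + t *: Om.
  by rewrite /N linearB /= trmx1 linearZ /= OmT scalerN opprK.
(* Invertibility holds for every [t], so the curve is defined on the whole line. *)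
have uN t : N t \in unitmx.
  by apply: unitmx_1B_skew; rewrite linearZ /= OmT scalerN.
pose C t := invmx (N t) *m (N t)^T.
have CC t : C t *m (C t)^T = 1%:M.
  have NNT : (N t)^T *m N t = N t *m (N t)^T.
    rewrite NT /N; set T := t *: Om.
    rewrite [LHS]mulmxBr mulmx1 [X in _ - X]mulmxDl mul1mx.
    rewrite [RHS]mulmxDr mulmx1 [X in _ = _ + X]mulmxBl mul1mx.
    by rewrite opprD !addrA addrK subrK.
  rewrite /C trmx_mul trmxK mulmxA -(mulmxA (invmx _)) NNT mulmxA mulVmx //.
  by rewrite mul1mx trmx_inv mulmxV // unitmx_tr.
have CTC t : (C t)^T *m C t = 1%:M by exact: mulmx1C.
(* Since [A *m x.2 = 0], the product (X + t A) P stays zero for all [t]. The remaining part Xdot P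
   of the velocity is supplied by the rotation [C]. *)
pose A := u.1 *m (1%:M - x.2).
have AP : A *m x.2 = 0 by rewrite /A -mulmxA mulmxBl mul1mx PP subrr mulmx0.
have C0 : C 0 = 1%:M by rewrite /C /N scale0r subr0 trmx1 invmx1 mulmx1.
have CkN' k : Ck_on k setT N.
  by apply: CkB; [exact: Ck_cst|apply: Ck_scalel; exact: Ck_id].
have CkC k : Ck_on k setT C.
  by apply: Ck_mulmx; [exact: Ck_invmx|exact: Ck_trmx].
(* Differentiated at 0, this implicit relation yields C'(0) = 2 Om without differentiating the
   inverse of [N t]. *)
have NC t : N t *m C t = 1%:M + t *: Om.
  by rewrite /C mulmxA mulmxV // mul1mx NT.
clearbody C.
pose c (t : R) : ambient R m n :=
  ((x.1 + t *: A) *m (C t)^T, C t *m x.2 *m (C t)^T).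
have CkCT k : Ck_on k setT (fun t => (C t)^T) by exact: Ck_trmx.
have CkXA k : Ck_on k setT (fun t : R => x.1 + t *: A).
  by apply: CkD; [exact: Ck_cst|apply: Ck_scalel; exact: Ck_id].
have Ckc k : Ck_on k setT c.
  apply: Ck_pair; first exact: Ck_mulmx.
  by apply: Ck_mulmx => //; apply: Ck_mulmx => //; exact: Ck_cst.
have dtZ p q (B : 'M[R]_(p, q)) :
    diff_along (fun t : R => t *: B) (0 : R) (1 : R) B.
  have := diff_along_scalel B (diff_along_id (0 : R) (1 : R)).
  by rewrite scale1r.
have dC : diff_along C (0 : R) (1 : R) (2 *: Om).
  have dC0 : differentiable C 0 by have [+ _] := CkC 1%N; exact.
  have dN := diff_alongB (diff_along_cst (0 : R) (1 : R) 1%:M) (dtZ _ _ Om).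
  have dNT := diff_alongD (diff_along_cst (0 : R) (1 : R) 1%:M) (dtZ _ _ Om).
  split=> //; have [_] := diff_along_mulmx dN (conj dC0 erefl).
  have -> := funext NC.
  have [_ ->] := dNT.
  rewrite C0 scale0r subr0 mulmx1 mul1mx sub0r add0r => /eqP.
  by rewrite eq_sym addrC subr_eq => /eqP ->; rewrite scaler_nat mulr2n.
have [Om2 OmP POm] : [/\ 2 *: Om = u.2 *m x.2 - x.2 *m u.2,
    (2 *: Om) *m x.2 = u.2 *m x.2 & x.2 *m (2 *: Om) = - (x.2 *m u.2)].
  have E : 2 *: Om = u.2 *m x.2 - x.2 *m u.2.
    by rewrite scalerA divff ?scale1r // pnatr_eq0.
  rewrite E mulmxBl mulmxBr !mulmxA PP PDP -mulmxA PP.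
  by rewrite subr0 sub0r.
exists c; split.
- exists setT; split=> // [|t _]; first exact: openT.
  split; last first.
    rewrite /= !mulmxA -(mulmxA _ (C t)^T) CTC mulmx1.
    by rewrite mulmxDl -scalemxAl XP AP scaler0 addr0 mul0mx.
  split=> /=.
  + by rewrite !trmx_mul trmxK PT mulmxA.
  + by rewrite !mulmxA -(mulmxA _ (C t)^T) CTC mulmx1 -(mulmxA _ x.2 x.2) PP.
  + have uC : C t \in unitmx by have [] := mulmx1_unit (CC t).
    rewrite mxrankMfree ?row_free_unit ?unitmx_tr //.
    by rewrite eqmxMfull // row_full_unit.
- by rewrite /c C0 trmx1 scale0r addr0 !mulmx1 mul1mx -surjective_pairing.
- have d1 : diff_along (fun t : R => x.1 + t *: A) (0 : R) (1 : R) (0 + A).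
    exact: diff_alongD (diff_along_cst _ _ _) (dtZ _ _ A).
  have [dc Dc] := diff_along_pair (diff_along_mulmx d1 (diff_along_trmx dC))
    (diff_along_mulmx (diff_along_mulmx dC (diff_along_cst _ _ x.2))
       (diff_along_trmx dC)).
  apply: DeriveDef; first exact: diff_derivable.
  rewrite [LHS]Dc C0 trmx1 !mulmx1 scale0r addr0 add0r mulmx0 addr0 mul1mx.
  rewrite linearZ /= OmT scalerN OmP !mulmxN POm opprK -DE.
  (* Since X P = 0 and X Pdot P = X Pdot, the term X (2 Om) equals X Pdot = - Xdot P, which restores
     what [A] leaves out. *)
  have -> : A - x.1 *m (2 *: Om) = u.1.
    rewrite Om2 mulmxBr !mulmxA XP mul0mx subr0 /A mulmxBr mulmx1.
    have : x.1 *m u.2 *m x.2 = x.1 *m u.2.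
      by rewrite [in RHS]DE mulmxDr !mulmxA XP mul0mx addr0.
    move=> ->; move/eqP: DX; rewrite addr_eq0 => /eqP ->.
    by rewrite opprK addrK.
  by rewrite -surjective_pairing.
Qed.

Lemma tangent_desingB x u v : M x -> tangent M x u -> tangent M x v ->
  tangent M x (u - v).
Proof.
move=> Mx /tangent_tangent_eqs [uT uE uX] /tangent_tangent_eqs [vT vE vX].
apply: tangent_eqs_tangent => //; split => /=.
- by rewrite linearB /= uT vT.
- by rewrite mulmxBl mulmxBr {1}uE {1}vE opprD addrACA.
- by rewrite mulmxBl mulmxBr addrACA uX -opprD vX subrr.
Qed.

(* A polynomial tangent field extending the tangent vector [v]. *)
Definition tangent_ext2 (v x : ambient R m n) : 'M[R]_n :=
  x.2 *m v.2 *m (1%:M - x.2) + (1%:M - x.2) *m v.2^T *m x.2.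

Definition tangent_ext v x : ambient R m n :=
  (v.1 *m (1%:M - x.2) - x.1 *m tangent_ext2 v x, tangent_ext2 v x).

(** [tangent_ext2] keeps the two off-diagonal blocks of [v.2] with respect to P, and these make up
    all of [v.2] when v is tangent. *)
Lemma tangent_extE v x : M x -> tangent M x v -> tangent_ext v x = v.
Proof.
move=> Mx /tangent_tangent_eqs Tv; have PDP := tangent_eqs_PDP Mx Tv.
have [vT vE vX] := Tv.
have E2 : tangent_ext2 v x = v.2.
  rewrite /tangent_ext2 vT mulmxBr !mulmxBl mulmx1 mul1mx PDP !subr0 addrC.
  by rewrite -vE.
rewrite /tangent_ext E2 mulmxBr mulmx1.
move/eqP: vX; rewrite addrC addr_eq0 => /eqP ->.
by rewrite opprK subrK -surjective_pairing.
Qed.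

(** The transpose in the second summand of [tangent_ext2] gives symmetry for arbitrary [v]. In the
    first component, the term v.1 (1 - P) is annihilated by P, and the subtracted X L, with L the
    second component, satisfies X L P = X L. *)
Lemma tangent_ext_tangent v x : M x -> tangent M x (tangent_ext v x).
Proof.
move=> Mx; have [[PT PP rP] XP] := Mx; apply: tangent_eqs_tangent => //.
have PQ : x.2 *m (1%:M - x.2) = 0 by rewrite mulmxBr mulmx1 PP subrr.
have QP : (1%:M - x.2) *m x.2 = 0 by rewrite mulmxBl mul1mx PP subrr.
split => /=.
- by rewrite linearD /= !trmx_mul linearB /= trmx1 PT trmxK !mulmxA addrC.
- have -> : x.2 *m tangent_ext2 v x = x.2 *m v.2 *m (1%:M - x.2).
    by rewrite [LHS]mulmxDr !mulmxA PP PQ !mul0mx addr0.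
  have -> : tangent_ext2 v x *m x.2 = (1%:M - x.2) *m v.2^T *m x.2.
    rewrite [LHS]mulmxDl -(mulmxA (x.2 *m v.2)) QP mulmx0 add0r.
    by rewrite -(mulmxA _ x.2 x.2) PP.
  by rewrite addrC.
- have -> : x.1 *m tangent_ext2 v x = x.1 *m v.2^T *m x.2.
    rewrite /tangent_ext2 mulmxDr !mulmxA XP !mul0mx add0r.
    by rewrite mulmxBr mulmx1 XP subr0.
  rewrite mulmxBl -(mulmxA v.1) QP mulmx0 sub0r.
  by rewrite -(mulmxA _ x.2 x.2) PP addNr.
Qed.

Lemma Ck_1B2 k : Ck_on k setT (fun x => 1%:M - x.2).
Proof. by apply: CkB; [exact: Ck_cst|exact: Ck_snd]. Qed.

Lemma Ck_tangent_ext2 k v : Ck_on k setT (tangent_ext2 v).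
Proof.
have CB := Ck_1B2 k.
have C2 : Ck_on k setT (fun x => x.2) by exact: Ck_snd.
by apply: CkD; do 2 (apply: Ck_mulmx => //); exact: Ck_cst.
Qed.

Lemma Ck_tangent_ext k v : Ck_on k setT (tangent_ext v).
Proof.
have C2 := Ck_tangent_ext2 k v; apply: Ck_pair => //; apply: CkB.
  by apply: Ck_mulmx; [exact: Ck_cst|exact: Ck_1B2].
by apply: Ck_mulmx => //; exact: Ck_fst.
Qed.

Lemma tangent_ext_C1_field v : C1_field M (tangent_ext v).
Proof.
split; first by move=> x; exact: tangent_ext_tangent.
by apply: (@C1_on_mfdT _ _ _ _ _ (tangent_ext v)) => //; exact: Ck_tangent_ext.
Qed.

End Desingularization.

(** * Euclidean gradient and Hessian *)

Section EuclideanGradient.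
Context {R : realType} {m n : nat}.
Implicit Types (f : 'M[R]_(m, n) -> R).

Lemma derive_egrad f X H : differentiable f X -> 'D_H f X = frob (egrad f X) H.
Proof.
move=> df; rewrite deriveE // {1}(matrix_sum_delta H) frobE linear_sum.
apply: eq_bigr => i _; rewrite linear_sum; apply: eq_bigr => j _.
by rewrite linearZ /= -deriveE // mxE mulrC.
Qed.

Lemma Ck_egrad f k : Ck_on k.+1 setT f -> Ck_on k setT (egrad f).
Proof.
move=> [_ Df]; apply: Ck_mx => i j.
have -> : (fun X => egrad f X i j) = 'D_(delta_mx i j) f; last exact: Df.
by apply/funext => X; rewrite mxE.
Qed.

Lemma diff_along_egrad f X H : Ck_on 2 setT f ->
  diff_along (egrad f) X H (ehess f X H).
Proof. by move=> /Ck_egrad [df _]; split=> //; exact: df. Qed.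

End EuclideanGradient.

(** * The weighted inner product of the ambient space *)

Section AmbientInnerProduct.
Context {R : realType} {m n : nat} (alpha : R).

Lemma ambient_ipC (v w : ambient R m n) :
  ambient_ip alpha v w = ambient_ip alpha w v.
Proof. by rewrite /ambient_ip frobC (frobC v.2). Qed.

Lemma ambient_ip_linear (v : ambient R m n) : linear (ambient_ip alpha v).
Proof.
move=> a w z; rewrite /ambient_ip /= !linearD !linearZ /= /GRing.scale /=.
ring.
Qed.

Lemma ambient_ip_is_bilinear :
  bilinear_for (GRing.Scale.Law.clone _ _ *:%R _)
    (GRing.Scale.Law.clone _ _ *:%R _) (@ambient_ip R m n alpha).
Proof.
split=> [w|v] a y z /=; last exact: ambient_ip_linear.
by rewrite !(ambient_ipC _ w) ambient_ip_linear.
Qed.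

HB.instance Definition _ :=
  bilinear_isBilinear.Build R (ambient R m n) (ambient R m n) R _ _
    (@ambient_ip R m n alpha) ambient_ip_is_bilinear.

Lemma ambient_ip_continuous :
  continuous (fun p : ambient R m n * ambient R m n => ambient_ip alpha p.1 p.2).
Proof.
suff C0 k : Ck_on k setT
    (fun p : ambient R m n * ambient R m n => ambient_ip alpha p.1 p.2).
  by move=> p; exact: (C0 0%N).
have C1 := @Ck_fst _ (ambient R m n) (ambient R m n) k.
have C2 := @Ck_snd _ (ambient R m n) (ambient R m n) k.
apply: CkD; last (apply: CkM; first exact: Ck_cst); apply: Ck_frob.
- exact: (Ck_linear (h := fst) (@fst_continuous _ _ _) C1).
- exact: (Ck_linear (h := fst) (@fst_continuous _ _ _) C2).
- exact: (Ck_linear (h := snd) (@snd_continuous _ _ _) C1).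
- exact: (Ck_linear (h := snd) (@snd_continuous _ _ _) C2).
Qed.

Lemma ambient_ip_eq0 (v : ambient R m n) : 0 < alpha ->
  ambient_ip alpha v v = 0 -> v = 0.
Proof.
move=> a0 /eqP; rewrite paddr_eq0 ?frob_ge0 ?mulr_ge0 ?frob_ge0 ?ltW //.
rewrite mulf_eq0 (gt_eqF a0) /= => /andP[/eqP/frob_eq0 v1 /eqP/frob_eq0 v2].
by rewrite (surjective_pairing v) v1 v2.
Qed.

End AmbientInnerProduct.

(** * The Riemannian gradient, and the Hessian tested against tangent vectors *)

Section RiemannianGradient.
Context {R : realType} {m n r : nat} (alpha : R) (f : 'M[R]_(m, n) -> R).
Hypothesis alpha_gt0 : 0 < alpha.
Hypothesis f_C2 : Ck_on 2 setT f.
Local Notation M := (@desing R m n r).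
Local Notation E := (ambient R m n).
Local Notation g := (fun x : E => f x.1).
Implicit Types x u v z : E.

(** The n x n counterpart of S(alpha), independent of any representation: it maps [V] to V
    S(alpha). *)
Definition regularized_gram (X : 'M[R]_(m, n)) : 'M[R]_n :=
  (2 * alpha)%:M + X^T *m X.

(** The solution C of (2 alpha + X^T X) C = X^T F P, with F the Euclidean gradient. On the manifold
    C = (1 - P) C P, and - C is the corresponding off-diagonal block of the second component of the
    gradient. *)
Definition grad_core x : 'M[R]_n :=
  invmx (regularized_gram x.1) *m x.1^T *m egrad f x.1 *m x.2.

Definition grad_formula x : E :=
  (egrad f x.1 *m (1%:M - x.2) + x.1 *m grad_core x,
   - (grad_core x + (grad_core x)^T)).

Lemma regularized_gram_unit X : regularized_gram X \in unitmx.
Proof. by apply: unitmx_scalarD_gram; rewrite mulr_gt0. Qed.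

(** As [regularized_gram] is invertible at every matrix, the formula makes sense on the whole
    ambient space; one of the two derivatives of [f] is spent on [egrad f]. *)
Lemma Ck_grad_formula : Ck_on 1 setT grad_formula.
Proof.
have C1 : Ck_on 1 setT (fun x : E => x.1) by exact: Ck_fst.
have C2 : Ck_on 1 setT (fun x : E => x.2) by exact: Ck_snd.
have CF : Ck_on 1 setT (fun x : E => egrad f x.1).
  exact: (Ck_precomp_linear (h := fst) (@fst_continuous _ _ _) (Ck_egrad f_C2)).
have C1T := Ck_trmx C1.
have CT : Ck_on 1 setT (fun x : E => invmx (regularized_gram x.1)).
  apply: Ck_invmx => [x|]; first exact: regularized_gram_unit.
  exact: (CkD (Ck_cst _ _ _) (Ck_mulmx C1T C1)).
have CC : Ck_on 1 setT grad_core.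
  exact: (Ck_mulmx (Ck_mulmx (Ck_mulmx CT C1T) CF) C2).
apply: Ck_pair; last exact: (CkN (CkD CC (Ck_trmx CC))).
exact: (CkD (Ck_mulmx CF (Ck_1B2 _)) (Ck_mulmx C1 CC)).
Qed.

Lemma grad_coreP x : M x -> grad_core x *m x.2 = grad_core x.
Proof. by move=> [[_ PP _] _]; rewrite /grad_core -(mulmxA _ x.2 x.2) PP. Qed.

(** From P X^T = 0 follows P G = 2 alpha P for the regularized Gram matrix G, so P commutes past its
    inverse up to a scalar and meets X^T again. *)
Lemma grad_core_projl x : M x -> x.2 *m grad_core x = 0.
Proof.
move=> [[PT _ _] XP].
have PXT : x.2 *m x.1^T = 0 by rewrite -PT -trmx_mul XP trmx0.
have PS : x.2 *m regularized_gram x.1 = (2 * alpha) *: x.2.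
  by rewrite mulmxDr mul_mx_scalar mulmxA PXT mul0mx addr0.
have a0 : 2 * alpha != 0 by rewrite mulf_neq0 ?pnatr_eq0 ?gt_eqF.
have PSi : x.2 *m invmx (regularized_gram x.1) = (2 * alpha)^-1 *: x.2.
  apply: (can_inj (mulmxK (regularized_gram_unit x.1))).
  rewrite mulmxKV ?regularized_gram_unit // -scalemxAl PS scalerA mulVf //.
  by rewrite scale1r.
by rewrite /grad_core !mulmxA PSi -!scalemxAl PXT !mul0mx scaler0.
Qed.

Lemma grad_formula_tangent x : M x -> tangent M x (grad_formula x).
Proof.
move=> Mx; have [[PT PP _] XP] := Mx; apply: tangent_eqs_tangent => //.
have CP := grad_coreP Mx; have PC := grad_core_projl Mx.
have PCT : x.2 *m (grad_core x)^T = (grad_core x)^T.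
  by rewrite -{1}PT -trmx_mul CP.
have CTP : (grad_core x)^T *m x.2 = 0 by rewrite -PT -trmx_mul PC trmx0.
split=> /=.
- by rewrite linearN linearD /= trmxK addrC.
- by rewrite mulNmx mulmxN mulmxDl mulmxDr CP PC PCT CTP addr0 add0r opprD.
- rewrite mulmxDl -(mulmxA (egrad f x.1)) mulmxBl mul1mx PP subrr mulmx0 add0r.
  rewrite -(mulmxA x.1) CP.
  by rewrite mulmxN mulmxDr -PCT (mulmxA x.1 x.2) XP mul0mx addr0 subrr.
Qed.

(** Substituting v.1 P = - X v.2 leaves <F, v.1> + <F, X v.2> - <G C, v.2>, with F the Euclidean
    gradient, G the regularized Gram matrix and C = [grad_core x]. The last two terms cancel by the
    equation defining C, since P X^T = 0. *)
Lemma grad_formula_ip x v : M x -> tangent M x v ->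
  ambient_ip alpha (grad_formula x) v = frob (egrad f x.1) v.1.
Proof.
move=> Mx /tangent_tangent_eqs [vT vE vX]; have [[PT PP _] XP] := Mx.
have CP := grad_coreP Mx.
have SC : regularized_gram x.1 *m grad_core x = x.1^T *m egrad f x.1 *m x.2.
  by rewrite /grad_core !mulmxA mulmxV ?regularized_gram_unit // mul1mx.
have vX' : v.1 *m x.2 = - (x.1 *m v.2) by apply/eqP; rewrite -addr_eq0 vX.
rewrite /ambient_ip /= frobDl mulmxBr mulmx1 frobDl !frobNl frobDl.
have -> : frob (grad_core x)^T v.2 = frob (grad_core x) v.2.
  by rewrite -[in LHS]vT frob_tr.
have -> : frob (egrad f x.1 *m x.2) v.1 = - frob (egrad f x.1) (x.1 *m v.2).
  by rewrite -[in LHS]PT -frob_mulmxr vX' frobNr.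
have -> : frob (x.1 *m grad_core x) v.1 =
    - frob (x.1^T *m x.1 *m grad_core x) v.2.
  rewrite -{1}CP mulmxA -{1}PT -frob_mulmxr vX' frobNr.
  by rewrite frob_mulmxl mulmxA.
have : frob (regularized_gram x.1 *m grad_core x) v.2 =
    frob (egrad f x.1) (x.1 *m v.2).
  have v2P : v.2 *m x.2 = v.2 - x.2 *m v.2 by rewrite {2}vE addrK.
  have PXT : x.2 *m x.1^T = 0 by rewrite -PT -trmx_mul XP trmx0.
  have -> : frob (regularized_gram x.1 *m grad_core x) v.2 =
      frob (x.1^T *m egrad f x.1) (v.2 *m x.2) by rewrite frob_mulmxr PT SC.
  rewrite v2P frobDr frobNr (frob_mulmxl _ x.2) PT (mulmxA x.2) PXT mul0mx.
  by rewrite frob0l subr0 [RHS]frob_mulmxl.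
rewrite mulmxDl mul_scalar_mx frobDl frobC linearZ /= /GRing.scale /= frobC.
lra.
Qed.

Lemma mdiff_comp_fst x v : tangent M x v ->
  mdiff M g x v = frob (egrad f x.1) v.1.
Proof.
move=> Tv; have [/(_ x.1 I) df _] := f_C2.
have [dg Dg] := diff_along_precomp_linear (h := fst) (@fst_continuous _ _ _)
  (conj df (derive_egrad v.1 df)).
by rewrite (mdiff_setT Tv dg).
Qed.

(** The difference between the chosen gradient and the formula is tangent and orthogonal to every
    tangent vector, in particular to itself. *)
Lemma rgradE x : M x -> rgrad M (ambient_ip alpha) g x = grad_formula x.
Proof.
move=> Mx; set w := rgrad _ _ _ _.
have [Tw wE] : [set w | tangent M x w /\ forall v, tangent M x v ->
    ambient_ip alpha w v = mdiff M g x v] w.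
  apply: (@xgetPex _ 0); exists (grad_formula x); split.
    exact: grad_formula_tangent.
  by move=> v Tv; rewrite grad_formula_ip // mdiff_comp_fst.
have Td := tangent_desingB Mx Tw (grad_formula_tangent Mx).
apply/eqP; rewrite -subr_eq0; apply/eqP/(ambient_ip_eq0 alpha_gt0).
by rewrite linearBl /= wE // grad_formula_ip // mdiff_comp_fst // subrr.
Qed.

Lemma rgrad_C1_field : C1_field M (rgrad M (ambient_ip alpha) g).
Proof.
split=> [x Mx|]; first by rewrite rgradE //; exact: grad_formula_tangent.
by apply: (C1_on_mfdT Ck_grad_formula) => y My; rewrite rgradE.
Qed.

(* The second fundamental form of [desing], evaluated on tangent vectors u and
   z, is the normal part of the derivative of [tangent_ext z] along u. *)
Definition dtangent_ext2 x u z : 'M[R]_n :=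
  u.2 *m z.2 *m (1%:M - x.2) - x.2 *m z.2 *m u.2
  - u.2 *m z.2 *m x.2 + (1%:M - x.2) *m z.2 *m u.2.

Lemma diff_along_tangent_ext x u z : M x -> tangent M x z ->
  diff_along (tangent_ext z) x u
    (- (z.1 *m u.2) - (u.1 *m z.2 + x.1 *m dtangent_ext2 x u z),
     dtangent_ext2 x u z).
Proof.
(* In the product rule for X times [tangent_ext2 z], the undifferentiated second factor is its value
   at [x], namely [z.2]. *)
move=> Mx Tz; have /(congr1 snd) /= L := tangent_extE Mx Tz.
have [zT _ _] := tangent_tangent_eqs Tz.
have d1 := diff_along_fst x u; have d2 := diff_along_snd x u.
have dc p q (B : 'M[R]_(p, q)) := diff_along_cst x u B.
have dQ := diff_alongB (dc _ _ 1%:M) d2.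
have dL : diff_along (tangent_ext2 z) x u (dtangent_ext2 x u z).
  have [dL DL] := diff_alongD
    (diff_along_mulmx (diff_along_mulmx d2 (dc _ _ z.2)) dQ)
    (diff_along_mulmx (diff_along_mulmx dQ (dc _ _ z.2^T)) d2).
  split; first exact: dL.
  by rewrite [LHS]DL !mulmx0 !addr0 !sub0r zT mulmxN !mulNmx addrA.
have := diff_along_pair
  (diff_alongB (diff_along_mulmx (dc _ _ z.1) dQ) (diff_along_mulmx d1 dL)) dL.
by rewrite mul0mx add0r sub0r mulmxN L.
Qed.

(** The last two terms are <(F, 0) - grad g, DZ[u]> written out, where (F, 0) - grad g = (F P - X C,
    C + C^T), F = [egrad f x.1] and C = [grad_core]; the sign of the first component of DZ[u] is
    absorbed into the factor X C - F P. *)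
Lemma rhess_ip nabla x u z :
  levi_civita M (ambient_ip alpha) nabla -> M x -> tangent M x u ->
  tangent M x z ->
  ambient_ip alpha (rhess M (ambient_ip alpha) nabla g x u) z =
    frob (ehess f x.1 u.1) z.1 +
    frob (x.1 *m grad_core x - egrad f x.1 *m x.2)
      (z.1 *m u.2 + u.1 *m z.2 + x.1 *m dtangent_ext2 x u z) +
    alpha * frob (grad_core x + (grad_core x)^T) (dtangent_ext2 x u z).
Proof.
move=> lc Mx Tu Tz; rewrite /rhess; set G := rgrad _ _ _.
have Gx : G x = grad_formula x := rgradE Mx.
have CG : C1_field M G by exact: rgrad_C1_field.
have Cu := tangent_ext_C1_field (r := r) u.
have Cz := tangent_ext_C1_field (r := r) z.
have := levi_civita_ambient (@ambient_ip_continuous _ m n alpha)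
  (ambient_ipC alpha) (@tangent_desingB R m n r) Mx lc Cu CG Cz.
rewrite !(tangent_extE Mx) // => ->.
have [dZ DZ] := diff_along_tangent_ext u Mx Tz.
have := mdiff_ip (@ambient_ip_continuous _ m n alpha) Mx Tu CG.2 Cz.2.
rewrite (tangent_extE Mx) // (mdiff_setT Tu dZ) DZ Gx.
rewrite (@eq_mdiff _ _ _ _ _ (fun y => frob (egrad f y.1) (tangent_ext z y).1));
  last first.
  move=> y My; rewrite /G rgradE //= grad_formula_ip //.
  exact: tangent_ext_tangent.
have dF : diff_along (fun y : E => egrad f y.1) x u (ehess f x.1 u.1).
  exact: (diff_along_precomp_linear (h := fst) (@fst_continuous _ _ _)
    (diff_along_egrad _ _ f_C2)).
have dZ1 : diff_along (fun y => (tangent_ext z y).1) x u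
    (- (z.1 *m u.2) - (u.1 *m z.2 + x.1 *m dtangent_ext2 x u z)).
  exact: (diff_along_linear (h := fst) (@fst_continuous _ _ _) (conj dZ DZ)).
have [d D] := diff_along_frob dF dZ1.
rewrite (mdiff_setT Tu d) D (tangent_extE Mx) // => /eqP.
rewrite eq_sym -subr_eq => /eqP <-.
move: (mdiff M G x u) (dtangent_ext2 x u z) => DG DL /=.
rewrite /ambient_ip /= mulmxBr mulmx1 !(frobDl, frobDr, frobNl, frobNr).
ring.
Qed.
End RiemannianGradient.

(** * Computations in a fixed representation of the base point *)

Section Representations.
Context {R : realType} {m n r : nat} {x : ambient R m n}
  {U : 'M[R]_(m, r)} {Sigma : 'M[R]_r} {V : 'M[R]_(n, r)}.
Hypothesis Mx : @desing R m n r x.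
Hypothesis x_repr : point_repr x U Sigma V.
Local Notation M := (@desing R m n r).
Implicit Types (K : 'M[R]_(m, r)) (W : 'M[R]_(n, r)) (u z : ambient R m n).

Let UU : U^T *m U = 1%:M. Proof. by have [[]] := x_repr. Qed.
Let VV : V^T *m V = 1%:M. Proof. by have [[]] := x_repr. Qed.
Let x1E : x.1 = U *m Sigma *m V^T. Proof. by have [_ _ _ _ []] := x_repr. Qed.
Let x2E : x.2 = 1%:M - V *m V^T. Proof. by have [_ _ _ _ []] := x_repr. Qed.

Lemma repr_SigmaT : Sigma^T = Sigma.
Proof.
have [_ /is_diag_mxP dS _ _ _] := x_repr.
apply/matrixP => i j; rewrite mxE; have [->//|ij] := eqVneq i j.
by rewrite !dS // eq_sym.
Qed.

Lemma repr_projV : x.2 *m V = 0.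
Proof. by rewrite x2E mulmxBl mul1mx -mulmxA VV mulmx1 subrr. Qed.

Lemma repr_projVT : V^T *m x.2 = 0.
Proof. by rewrite x2E mulmxBr mulmx1 mulmxA VV mul1mx subrr. Qed.

Lemma repr_orthV p (B : 'M[R]_(n, p)) : V^T *m B = 0 -> x.2 *m B = B.
Proof. by move=> VB; rewrite x2E mulmxBl mul1mx -mulmxA VB mulmx0 subr0. Qed.

Lemma tangent_repr_orthT u K W : tangent_repr U Sigma V u K W -> V^T *m W = 0.
Proof. by move=> [WV _ _]; rewrite -[LHS]trmxK trmx_mul trmxK WV trmx0. Qed.

Lemma tangent_repr_tangent u K W : tangent_repr U Sigma V u K W -> tangent M x u.
Proof.
move=> uR; have VW := tangent_repr_orthT uR; have [WV u1 u2] := uR.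
have PT : x.2^T = x.2 by have [[]] := Mx.
have PW := repr_orthV VW.
have WP : W^T *m x.2 = W^T by rewrite -{1}PT -trmx_mul PW.
apply: tangent_eqs_tangent => //; split.
- by rewrite u2 linearB linearN /= !trmx_mul !trmxK addrC.
- rewrite u2 mulmxBl mulmxBr mulNmx mulmxN -!mulmxA repr_projVT WP !mulmxA.
  by rewrite PW repr_projV mulmx0 mul0mx oppr0 sub0r addr0 addrC.
- rewrite u1 u2 mulmxDl -!mulmxA repr_projVT WP mulmx0 add0r x1E.
  rewrite mulmxBr mulmxN -!mulmxA (mulmxA V^T W) VW mul0mx !mulmx0 oppr0 sub0r.
  by rewrite (mulmxA V^T V) VV mul1mx subrr.
Qed.

(** The witnesses come from multiplying the two formulas of a representation by [V] on the right:
    Xdot V = K and Pdot V = - Vp. *)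
Lemma tangent_has_repr u : tangent M x u ->
  exists K W, tangent_repr U Sigma V u K W.
Proof.
move=> /tangent_tangent_eqs [uT uE uX].
have VVT : V *m V^T = 1%:M - x.2 by rewrite x2E opprB addrC subrK.
have V2V : V^T *m u.2 *m V = 0.
  rewrite uE mulmxDr mulmxDl !mulmxA repr_projVT !mul0mx addr0.
  by rewrite -(mulmxA _ x.2) repr_projV mulmx0.
exists (u.1 *m V), (- (u.2 *m V)); split.
- by rewrite linearN /= trmx_mul uT mulNmx V2V oppr0.
- rewrite linearN /= trmx_mul uT mulmxN mulmxA -x1E -!mulmxA VVT.
  have -> : x.1 *m u.2 = - (u.1 *m x.2).
    by apply/eqP; rewrite -addr_eq0 addrC uX.
  by rewrite mulmxBr mulmx1 opprK subrK.
- rewrite linearN /= trmx_mul uT mulNmx mulmxN !opprK -(mulmxA u.2) (mulmxA V) VVT.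
  by rewrite mulmxBr mulmxBl mulmx1 mul1mx addrACA -opprD -uE addrK.
Qed.

(** The relations V^T V = 1 and Vp^T V = 0 remove the cross terms. The X component contributes the
    weight Sigma^2, and the two halves of the P component contribute alpha each: this is how
    S(alpha) enters. *)
Lemma ambient_ip_repr alpha u z K W K' W' :
  tangent_repr U Sigma V u K W -> tangent_repr U Sigma V z K' W' ->
  ambient_ip alpha u z =
    frob K K' + frob (W *m ((2 * alpha)%:M + Sigma *m Sigma)) W'.
Proof.
move=> uR zR; have VW := tangent_repr_orthT uR.
have VW' := tangent_repr_orthT zR; have [WV u1 u2] := uR.
have [WV' z1 z2] := zR; have ST := repr_SigmaT.
rewrite /ambient_ip u1 u2 z1 z2 !(frobDl, frobDr, frobNl, frobNr) !opprK.
have orth p (A B : 'M[R]_(p, r)) (C D : 'M[R]_(n, r)) :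
    frob (A *m C^T) (B *m D^T) = frob (A *m (C^T *m D)) B.
  by rewrite frob_mulmxr trmxK mulmxA.
have VWWV : frob (V *m (W^T *m W')) V = frob W W'.
  by rewrite frobC frob_mulmxl VV frob_mulmxl trmxK mulmx1.
have SWWS : frob (U *m Sigma *m (W^T *m W')) (U *m Sigma) =
    frob (W *m (Sigma *m Sigma)) W'.
  rewrite frobC frob_mulmxl trmx_mul ST mulmxA -(mulmxA Sigma) UU mulmx1.
  by rewrite frob_mulmxl trmxK.
rewrite !orth VV WV VW' VWWV SWWS !mulmx0 !mulmx1 !frob0l !addr0 !add0r.
rewrite mulmxDr mul_mx_scalar frobDl [frob (_ *: _) _]frobC linearZ /=.
rewrite /GRing.scale /= (frobC W').
ring.
Qed.

(** The trailing factor V^T shows that [dtangent_ext2] has no block from ran P to ran V, whereas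
    tangent vectors have only off-diagonal blocks. *)
Lemma repr_dtangent_ext2 u z K W K' W' :
  tangent_repr U Sigma V u K W -> tangent_repr U Sigma V z K' W' ->
  V^T *m dtangent_ext2 x u z = (W^T *m W' + W'^T *m W) *m V^T.
Proof.
move=> uR zR; have VW := tangent_repr_orthT uR.
have VW' := tangent_repr_orthT zR; have [WV u1 u2] := uR.
have [WV' z1 z2] := zR.
have Vu : V^T *m u.2 = - W^T.
  by rewrite u2 mulmxBr mulmxN !mulmxA VW VV mul0mx mul1mx oppr0 sub0r.
have Vz : V^T *m z.2 = - W'^T.
  by rewrite z2 mulmxBr mulmxN !mulmxA VW' VV mul0mx mul1mx oppr0 sub0r.
have Wz : W^T *m z.2 = - (W^T *m W' *m V^T).
  by rewrite z2 mulmxBr mulmxN !mulmxA WV mul0mx subr0.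
have Wu : W'^T *m u.2 = - (W'^T *m W *m V^T).
  by rewrite u2 mulmxBr mulmxN !mulmxA WV' mul0mx subr0.
rewrite /dtangent_ext2 [LHS]mulmxDr !mulmxBr !mulmxA mulmxBr !mulmx1.
rewrite repr_projVT Vu subr0 !mul0mx Vz !mulNmx Wz Wu !mulNmx !opprK subr0.
rewrite -(mulmxA _ V^T) repr_projVT mulmx0 !subr0.
by rewrite mulmxDl.
Qed.

Lemma dtangent_ext2_sym u z : tangent M x u -> tangent M x z ->
  (dtangent_ext2 x u z)^T = dtangent_ext2 x u z.
Proof.
move=> /tangent_tangent_eqs [uT _ _] /tangent_tangent_eqs [zT _ _].
have [[PT _ _] _] := Mx.
have trB (A B : 'M[R]_n) : (A - B)^T = A^T - B^T by rewrite linearB.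
have trD (A B : 'M[R]_n) : (A + B)^T = A^T + B^T by rewrite linearD.
rewrite /dtangent_ext2 trD !trB !trmx_mul trB trmx1 uT zT PT !mulmxA.
by rewrite [LHS]addrC -[RHS]addrA -[RHS]addrA; congr (_ + _);
  rewrite [LHS]addrC; congr (_ + _); rewrite addrC.
Qed.

(** * Pairings of the derivative terms with a matrix that annihilates [V] *)

Section NormalPairing.
Context (N : 'M[R]_(m, n)).
Hypothesis NV : N *m V = 0.

(** The part of Pdot ending in V^T pairs to zero because N V = 0; in the other part z.1 V = K'. *)
Lemma frob_normal_mul u z K W K' W' :
  tangent_repr U Sigma V u K W -> tangent_repr U Sigma V z K' W' ->
  frob N (z.1 *m u.2) = - frob N (K' *m W^T).
Proof.
move=> [WV _ u2] [WV' z1 _].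
have z1V : z.1 *m V = K'.
  by rewrite z1 mulmxDl -!mulmxA VV WV' !mulmx0 mulmx1 addr0.
rewrite u2 mulmxBr mulmxN !mulmxA z1V frobDr !frobNr.
by rewrite (frob_mulmxr _ _ V^T) trmxK NV frob0l oppr0 add0r.
Qed.

Lemma frob_normal_dtangent_ext2 u z K W K' W' :
  tangent_repr U Sigma V u K W -> tangent_repr U Sigma V z K' W' ->
  frob N (x.1 *m dtangent_ext2 x u z) = 0.
Proof.
move=> uR zR; rewrite x1E -(mulmxA _ V^T) (repr_dtangent_ext2 uR zR) mulmxA.
by rewrite frob_mulmxr trmxK NV frob0l.
Qed.

End NormalPairing.

(** * The Hessian in a representation *)

Section HessianRepresentation.
Context {alpha : R} {f : 'M[R]_(m, n) -> R}.
Hypothesis alpha_gt0 : 0 < alpha.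
Hypothesis f_C2 : Ck_on 2 setT f.
Local Notation S := ((2 * alpha)%:M + Sigma *m Sigma).
Local Notation Mx' := (1%:M - U *m (Sigma *m Sigma) *m invmx S *m U^T).
Local Notation C := (grad_core alpha f x).

Lemma repr_S_unit : S \in unitmx.
Proof. by rewrite -{1}repr_SigmaT unitmx_scalarD_gram // mulr_gt0. Qed.

(** This is where the matrix M of the statement appears: with G the regularized Gram matrix, X G^-1
    X^T = U Sigma^2 S^-1 U^T. *)
Lemma repr_grad_normal :
  x.1 *m C - egrad f x.1 *m x.2 = - (Mx' *m egrad f x.1 *m x.2).
Proof.
(* This intertwining relation carries over to the inverses and reduces G^-1 to the r x r matrix
   S^-1. *)
have GV : regularized_gram alpha x.1 *m V = V *m S.
  rewrite /regularized_gram mulmxDl mulmxDr mul_mx_scalar mul_scalar_mx.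
  congr (_ + _); rewrite x1E !trmx_mul trmxK repr_SigmaT -!mulmxA.
  by rewrite VV mulmx1 (mulmxA U^T) UU mul1mx.
have GiV : invmx (regularized_gram alpha x.1) *m V = V *m invmx S.
  apply: (can_inj (mulmxK repr_S_unit)).
  rewrite -mulmxA -GV mulKmx ?regularized_gram_unit //.
  by rewrite -mulmxA mulVmx ?repr_S_unit // mulmx1.
have SS : Sigma *m S = S *m Sigma.
  by rewrite mulmxDr mulmxDl mul_mx_scalar mul_scalar_mx mulmxA.
have SiS : invmx S *m Sigma = Sigma *m invmx S.
  apply: (can_inj (mulmxK repr_S_unit)).
  rewrite -!mulmxA mulVmx ?repr_S_unit // mulmx1 SS.
  by rewrite mulKmx ?repr_S_unit.
have XTX : x.1 *m invmx (regularized_gram alpha x.1) *m x.1^T =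
    U *m (Sigma *m Sigma) *m invmx S *m U^T.
  rewrite {1 3}x1E !trmx_mul trmxK repr_SigmaT -!mulmxA.
  rewrite (mulmxA _ V) GiV -mulmxA (mulmxA V^T V) VV mul1mx.
  by rewrite (mulmxA (invmx S) Sigma) SiS -!mulmxA.
rewrite /grad_core !mulmxA XTX !mulmxBl mul1mx opprB.
by rewrite (mulmxA U).
Qed.

Lemma repr_grad_normalV : (x.1 *m C - egrad f x.1 *m x.2) *m V = 0.
Proof.
by rewrite repr_grad_normal mulNmx -(mulmxA _ x.2 V) repr_projV mulmx0 oppr0.
Qed.

(** From P C = 0 and C P = C, the matrix C has only one off-diagonal block, which is zero in
    [dtangent_ext2]. *)
Lemma frob_grad_core_dtangent_ext2 u z K W K' W' :
  tangent_repr U Sigma V u K W -> tangent_repr U Sigma V z K' W' ->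
  frob (C + C^T) (dtangent_ext2 x u z) = 0.
Proof.
move=> uR zR.
have DT := dtangent_ext2_sym (tangent_repr_tangent uR) (tangent_repr_tangent zR).
suff C0 : frob C (dtangent_ext2 x u z) = 0.
  by rewrite frobDl -{2}DT frob_tr C0 addr0.
have QC : V *m V^T *m C = C.
  have := grad_core_projl f alpha_gt0 Mx.
  by rewrite {1}x2E mulmxBl mul1mx => /eqP; rewrite subr_eq0 => /eqP {2}->.
have CV : C *m V = 0.
  by rewrite -(grad_coreP _ _ Mx) -mulmxA repr_projV mulmx0.
rewrite -QC -mulmxA frobC frob_mulmxl (repr_dtangent_ext2 uR zR) frobC.
by rewrite frob_mulmxr trmxK -mulmxA CV mulmx0 frob0l.
Qed.

(** The right-hand side has the shape of [ambient_ip_repr] with the weight S already multiplied into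
    the second factor; dividing by S gives the second component of the claimed representation. *)
Lemma rhess_ip_repr nabla u z K W K' W' :
  levi_civita M (ambient_ip alpha) nabla ->
  tangent_repr U Sigma V u K W -> tangent_repr U Sigma V z K' W' ->
  let Hf := ehess f x.1 u.1 in let F := egrad f x.1 in
  ambient_ip alpha (rhess M (ambient_ip alpha) nabla (fun y => f y.1) x u) z =
    frob (Hf *m V + Mx' *m F *m W) K' +
    frob (x.2 *m (Hf^T *m U *m Sigma + F^T *m Mx' *m K)) W'.
Proof.
move=> lc uR zR Hf F.
have Tu := tangent_repr_tangent uR; have Tz := tangent_repr_tangent zR.
have PT : x.2^T = x.2 by have [[]] := Mx.
have MT : Mx'^T = Mx'.
  have SiT : (invmx S)^T = invmx S.
    by rewrite trmx_inv linearD /= tr_scalar_mx trmx_mul repr_SigmaT.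
  have SSi : invmx S *m (Sigma *m Sigma) = Sigma *m Sigma *m invmx S.
    apply: (can_inj (mulmxK repr_S_unit)).
    rewrite -!mulmxA mulVmx ?repr_S_unit // mulmx1.
    have -> : Sigma *m (Sigma *m S) = S *m (Sigma *m Sigma).
      by rewrite !mulmxDr mulmxDl !mul_mx_scalar mul_scalar_mx -scalemxAr !mulmxA.
    by rewrite mulKmx ?repr_S_unit.
  rewrite linearB /= trmx1 !trmx_mul trmxK SiT repr_SigmaT; congr (_ - _).
  by rewrite (mulmxA (invmx S)) SSi !mulmxA.
have NV := repr_grad_normalV.
rewrite (rhess_ip alpha_gt0 f_C2 lc Mx Tu Tz).
rewrite (frob_grad_core_dtangent_ext2 uR zR) mulr0 addr0 !frobDr.
rewrite (frob_normal_dtangent_ext2 NV uR zR) addr0.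
(* The second use exchanges the roles of [u] and [z], to treat [u.1 *m z.2]. *)
rewrite (frob_normal_mul NV uR zR) (frob_normal_mul NV zR uR).
rewrite repr_grad_normal !frobNl !opprK -/F -/Hf.
have [_ -> _] := zR; have PW := repr_orthV (tangent_repr_orthT uR).
have PW' := repr_orthV (tangent_repr_orthT zR).
(* The projection costs nothing against W' since P W' = W'; it is what makes the resulting Vp
   orthogonal to [V]. *)
have -> : frob (x.2 *m (Hf^T *m U *m Sigma + F^T *m Mx' *m K)) W' =
    frob (Hf^T *m U *m Sigma + F^T *m Mx' *m K) W'.
  by rewrite -[in RHS]PW' frob_mulmxl PT.
rewrite frobDr !frobDl.
have -> : frob Hf (K' *m V^T) = frob (Hf *m V) K' by rewrite frob_mulmxr trmxK.
have -> : frob Hf (U *m Sigma *m W'^T) = frob (Hf^T *m U *m Sigma) W'.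
  by rewrite frob_mulmxl -[LHS]frob_tr trmxK trmx_mul trmxK mulmxA.
have -> : frob (Mx' *m F *m x.2) (K' *m W^T) = frob (Mx' *m F *m W) K'.
  by rewrite frob_mulmxr trmxK -(mulmxA _ x.2) PW.
have -> : frob (Mx' *m F *m x.2) (K *m W'^T) = frob (F^T *m Mx' *m K) W'.
  rewrite frob_mulmxl -[LHS]frob_tr trmxK !trmx_mul trmxK PT MT -!mulmxA.
  by rewrite -[in RHS]PW' frob_mulmxl PT.
ring.
Qed.

End HessianRepresentation.

End Representations.

(** * Identification of the Hessian through definiteness of the metric *)

Theorem proposition3p7 (R : realType) (m n r : nat)
  (r_gt0 : (0 < r)%N) (r_lt : (r < minn m n)%N)
  (alpha : R) (alpha_gt0 : 0 < alpha)
  (nabla : ambient R m n -> ambient R m n ->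
           (ambient R m n -> ambient R m n) -> ambient R m n)
  (nabla_lc : levi_civita (@desing R m n r) (ambient_ip alpha) nabla)
  (f : 'M[R]_(m, n) -> R) (f_C2 : Ck_on 2 setT f)
  (X : 'M[R]_(m, n)) (P : 'M[R]_n)
  (XP_mem : @desing R m n r (X, P))
  (Xdot : 'M[R]_(m, n)) (Pdot : 'M[R]_n)
  (XPdot_tangent : tangent (@desing R m n r) (X, P) (Xdot, Pdot))
  (U : 'M[R]_(m, r)) (Sigma : 'M[R]_r) (V : 'M[R]_(n, r))
  (XP_repr : point_repr (X, P) U Sigma V)
  (K : 'M[R]_(m, r)) (Vp : 'M[R]_(n, r))
  (XPdot_repr : tangent_repr U Sigma V (Xdot, Pdot) K Vp) :
  let g : ambient R m n -> R := fun x => f x.1 in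
  let H := rhess (@desing R m n r) (ambient_ip alpha) nabla g
             (X, P) (Xdot, Pdot) in
  let S : 'M[R]_r := (2 * alpha)%:M + Sigma *m Sigma in
  let Mx : 'M[R]_m :=
    1%:M - U *m (Sigma *m Sigma) *m invmx S *m U^T in
  let Kbar := ehess f X Xdot *m V + Mx *m egrad f X *m Vp in
  let Vpbar := P *m ((ehess f X Xdot)^T *m U *m Sigma
                     + (egrad f X)^T *m Mx *m K) *m invmx S in
  tangent (@desing R m n r) (X, P) H /\
  tangent_repr U Sigma V H Kbar Vpbar.
Proof.
move=> g H S Mx Kbar Vpbar.
have [cn _ _] := nabla_lc.
have TH : tangent (@desing R m n r) (X, P) H.
  by apply: (conn_tangent cn) => //; exact: rgrad_C1_field.
split=> //.
(* The vector that has the claimed representation by construction; it remains to show that it equals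
   the Hessian. *)
pose Hc : ambient R m n :=
  (Kbar *m V^T + U *m Sigma *m Vpbar^T, - (Vpbar *m V^T) - V *m Vpbar^T).
have HcR : tangent_repr U Sigma V Hc Kbar Vpbar.
  split=> //; have PV := repr_projV XP_repr.
  have PT : P^T = P by have [[]] := XP_mem.
  by rewrite /Vpbar -mulmxA !trmx_mul PT -!mulmxA PV !mulmx0.
suff -> : H = Hc by [].
have THc := tangent_repr_tangent XP_mem XP_repr HcR.
(* H - Hc is tangent, so it can serve as its own test vector: both pairings below are against this
   representation. *)
have [K' [W' dR]] := tangent_has_repr XP_repr (tangent_desingB XP_mem TH THc).
have uS : S \in unitmx := repr_S_unit XP_repr alpha_gt0.
apply/eqP; rewrite -subr_eq0; apply/eqP/(ambient_ip_eq0 alpha_gt0).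
rewrite linearBl /=.
rewrite (rhess_ip_repr XP_mem XP_repr alpha_gt0 f_C2 nabla_lc XPdot_repr dR).
(* The weight S of the metric cancels the factor S^-1 in [Vpbar], so both pairings coincide. *)
by rewrite (ambient_ip_repr XP_repr alpha HcR dR) mulmxKV // subrr.
Qed.
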